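(* Let $n\ge2$, $T\ge2$, $G=([T],\mathcal{E})$ a connected undirected graph with incidence matrix $D$ (any orientation), Laplacian $L=D^\top D$ with eigenvalues $\lambda_1\ge\cdots\ge\lambda_{T-1}>\lambda_T=0$, and $M=D\otimes I_n$. For each $t\in[T]$ let $G_t=([n],\mathcal{E}_t)$ be an undirected graph and $C_t\in\{-1,1,0\}^{|\mathcal{E}_t|\times n}$ the incidence matrix of some orientation of its edges; let $x_t\in\mathbb{R}^n$ with $\mathbf{1}_n^\top x_t=0$, and $y_t=C_tx_t+\eta_t$. Let $x,\eta,y$ be the column-stackings, $C=\mathrm{blockdiag}(C_1,\dots,C_T)$, $O_T^\top O_T=\sum_tC_t^\top C_t$, and $P=I_T\otimes(I_n-\frac1n\mathbf{1}_n\mathbf{1}_n^\top)$. Assume $\lambda_{n-1}(O_T^\top O_T)>0$, $\eta$ is a centered $\sigma$-subgaussian random vector, and $\|Mx\|_2^2\le S_T$. Let $b_1,b_2,b_3>0$ satisfy $$\lambda_{T-1}\ge b_1,\qquad\frac{\lambda_{n-1}(O_T^\top O_T)}{T}\ge b_2,\qquad 2\|C\|_2\frac{\lambda_{\max}^{1/2}(O_T^\top O_T)}{\sqrt T}\le b_3,$$ and for $\mu>0$ define $$\overline{\lambda'}(\mu)=\begin{cases}\dfrac{b_2^2}{2(b_2^2+b_3^2)}\mu b_1, & \text{if } \mu b_1<b_2+\dfrac{b_3^2-b_2^2}{2b_2},\\[2mm] \dfrac14\Big(1-\dfrac{\mu b_1-b_2}{\sqrt{b_3^2+(\mu b_1-b_2)^2}}\Big)\mu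 b_1+\dfrac{b_2}{4}+\dfrac{b_2(\mu b_1-b_2)-b_3^2}{4\sqrt{b_3^2+(\mu b_1-b_2)^2}}, & \text{otherwise,}\end{cases}$$ and $\overline{\lambda}(\mu)=\max\{\overline{\lambda'}(\mu),\lambda_{T(n-1)}(C^\top C)\}$. Let $\mu>0$. Then: (1) $\lambda_{T(n-1)}\big(P(\mu M^\top M+C^\top C)P\big)\ge\overline{\lambda}(\mu)$, and $\overline{\lambda'}(\mu)>0$; if $\mu b_1\ge b_2+\frac{b_3^2}{b_2}$ then $\overline{\lambda'}(\mu)\ge\frac{b_2}{4}$. (2) Let $\hat x=\big(P(\mu M^\top M+C^\top C)P\big)^\dagger C^\top y$. For any $\delta\in(0,e^{-1})$, with probability at least $1-\delta$, $$\|\hat x-x\|_2^2\le\frac{4\mu}{\overline{\lambda}(\mu)}S_T+40n\sigma^2\|C\|_2^2\Big(\sum_{t=1}^{T-1}\frac{1}{(\overline{\lambda}(\mu)+\mu\lambda_t)^2}+\frac{1}{\overline{\lambda}^2(\mu)}\Big)\log\Big(\frac1\delta\Big).$$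
   Context: Eigenvalues of an $N\times N$ symmetric matrix are ordered $\lambda_1\ge\cdots\ge\lambda_N$. $A^\dagger$ is the Moore–Penrose pseudoinverse. A random vector $Y$ is centered $\sigma$-subgaussian if $\mathbb{E}[Y]=0$ and $\mathbb{E}[e^{s\,u^\top Y}]\le e^{s^2\sigma^2/2}$ for all real $s$ and unit vectors $u$. $\hat x$ is the unique minimizer of $\frac12\|y-Cz\|_2^2+\frac\mu2\|Mz\|_2^2$ over $z$ in the column space of $P$. *)

(* Defs.v *)
From HB Require Import structures.
From mathcomp Require Import all_boot all_order all_algebra.
From mathcomp Require Import all_classical all_reals all_analysis.
Set Implicit Arguments. Unset Strict Implicit. Unset Printing Implicit Defensive.
Import Order.TTheory GRing.Theory Num.Theory.
Local Open Scope ring_scope.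
Local Open Scope classical_set_scope.

Section Defs.
Variable R : realType.

Definition incidence (m N : nat) (s d : 'I_m -> 'I_N) : 'M[R]_(m, N) :=
  \matrix_(e, v) ((v == s e)%:R - (v == d e)%:R).

Definition simple_graph (m N : nat) (s d : 'I_m -> 'I_N) : Prop :=
  (forall e, s e != d e) /\
  (forall e e', [set s e; d e]%SET = [set s e'; d e']%SET -> e = e').

Definition adj (m N : nat) (s d : 'I_m -> 'I_N) : rel 'I_N :=
  fun u v => [exists e, ((s e == u) && (d e == v)) || ((s e == v) && (d e == u))].

Definition connected_graph (m N : nat) (s d : 'I_m -> 'I_N) : Prop :=
  forall u v, connect (adj s d) u v.

Definition spectrum_of (N : nat) (A : 'M[R]_N) (sp : seq R) : Prop :=
  sorted (fun a b => b <= a) sp /\ char_poly A = \prod_(a <- sp) ('X - a%:P).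

Definition spectrum (N : nat) (A : 'M[R]_N) : seq R :=
  match pselect (exists sp, spectrum_of A sp) with
  | left h => sval (cid h)
  | right _ => [::]
  end.

(* eigval A k = lambda_k(A), 1-indexed: lambda_1 >= ... >= lambda_N *)
Definition eigval (N : nat) (A : 'M[R]_N) (k : nat) : R := nth 0 (spectrum A) k.-1.

Definition norm2 (N : nat) (v : 'cV[R]_N) : R := Num.sqrt (\sum_i v i 0 ^+ 2).

Definition opnorm2 (m N : nat) (A : 'M[R]_(m, N)) : R :=
  sup [set norm2 (A *m v) | v in [set v : 'cV[R]_N | norm2 v <= 1]].

Definition is_MP_pinv (m N : nat) (A : 'M[R]_(m, N)) (X : 'M[R]_(N, m)) : Prop :=
  [/\ A *m X *m A = A, X *m A *m X = X, (A *m X)^T = A *m X & (X *m A)^T = X *m A].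

Definition mp_pinv (m N : nat) (A : 'M[R]_(m, N)) : 'M[R]_(N, m) :=
  match pselect (exists X, is_MP_pinv A X) with
  | left h => sval (cid h)
  | right _ => 0
  end.

Definition centering (n : nat) : 'M[R]_n := 1%:M - const_mx (n%:R^-1).

Definition centered_subgaussian d (Omega : measurableType d)
    (P : probability Omega R) (N : nat) (Y : Omega -> 'cV[R]_N) (sigma : R) : Prop :=
  (forall i, measurable_fun setT (fun w => Y w i 0)) /\
  (forall i, P.-integrable setT (fun w => (Y w i 0)%:E) /\
             (\int[P]_w (Y w i 0)%:E = 0)%E) /\
  (forall (s : R) (u : 'cV[R]_N), norm2 u = 1 ->
     (\int[P]_w (expR (s * (u^T *m Y w) 0 0))%:E
        <= (expR (s ^+ 2 * sigma ^+ 2 / 2))%:E)%E).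

Definition lambar' (b1 b2 b3 mu : R) : R :=
  let a := mu * b1 - b2 in
  if mu * b1 < b2 + (b3 ^+ 2 - b2 ^+ 2) / (2 * b2) then
    b2 ^+ 2 / (2 * (b2 ^+ 2 + b3 ^+ 2)) * mu * b1
  else
    4^-1 * (1 - a / Num.sqrt (b3 ^+ 2 + a ^+ 2)) * mu * b1 + b2 / 4
    + (b2 * a - b3 ^+ 2) / (4 * Num.sqrt (b3 ^+ 2 + a ^+ 2)).

End Defs.

(* Main.v *)
(* On the range V of P write H = mu M^T M + C^T C, so that A acts as H on V.

   Splitting z in V into its mean over time and the deviation from it, with
   norms a and b, gives <z, H z> >= mu b1 b^2 + max (0, b2 a^2 - b3 a b), and
   minimising the right-hand side on the circle yields
   <z, H z> >= 2 lambar' |z|^2.  Averaging with H >= mu M^T M,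
   H >= (lb + mu M^T M) / 2 on V.

   The error is X C^T eta - p with X the pseudoinverse of A and
   p = X (mu M^T M x).  The bias satisfies |p|^2 <= (mu / lb) |M x|^2.  For the
   noise, |X C^T|_F^2 <= |C|^2 tr (X^2), and by monotonicity of the inverse
   tr (X^2) is at most 4 tr ((lb + mu M^T M)^-2).  A subgaussian quadratic form
   |B eta|^2 exceeds (15/2) sigma^2 |B|_F^2 tau with probability at most
   exp (- tau) when tau >= 1: Jensen over the rows of B reduces this to a bound
   on the scalar moments E exp (k <u, eta>^2).  Finally
   |q - p|^2 <= 4 |p|^2 + (4/3) |q|^2. *)
Require Import Defs.
From HB Require Import structures.
From mathcomp Require Import all_boot all_order all_algebra.
From mathcomp Require Import all_classical all_reals all_analysis.
From mathcomp Require Import perm complex measurable_realfun ring lra.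
Set Implicit Arguments. Unset Strict Implicit. Unset Printing Implicit Defensive.
Import Order.TTheory GRing.Theory Num.Theory.
Local Open Scope ring_scope.
Local Open Scope classical_set_scope.

(** * Diagonalization of real symmetric matrices *)

Lemma mulmx_tr_sum (R : comPzRingType) n (v w : 'rV[R]_n) :
  (v *m w^T) 0 0 = \sum_i v 0 i * w 0 i.
Proof. by rewrite !mxE; apply: eq_bigr => i _; rewrite !mxE. Qed.

Lemma mulmx_tr_ge0 (R : realDomainType) n (v : 'rV[R]_n) : 0 <= (v *m v^T) 0 0.
Proof.
by rewrite mulmx_tr_sum; apply: sumr_ge0 => i _; rewrite -expr2 sqr_ge0.
Qed.

Lemma mulmx_tr_eq0 (R : realDomainType) n (v : 'rV[R]_n) :
  (v *m v^T) 0 0 = 0 -> v = 0.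
Proof.
rewrite mulmx_tr_sum => /eqP; rewrite psumr_eq0 => [|i _]; last first.
  by rewrite -expr2 sqr_ge0.
move=> /allP h; apply/rowP => i; have := h i (mem_index_enum i).
by rewrite -expr2 sqrf_eq0 => /eqP ->; rewrite mxE.
Qed.

(* If [x + iy] is an eigenvalue, some real [v] is killed by [(A - x)^2 + y^2];
   pairing with [v] gives [|v (A - x)|^2 + y^2 |v|^2 = 0]. *)
Lemma symmetric_eigenvector (R : rcfType) n (A : 'M[R]_n.+1) :
  A^T = A -> exists a (v : 'rV[R]_n.+1), v *m A = a *: v /\ (v *m v^T) 0 0 = 1.
Proof.
move=> sA; pose f : {rmorphism R -> R[i]} := real_complex R.
have /closed_rootP [c] : size (char_poly (map_mx f A)) != 1%N.
  by rewrite size_char_poly.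
rewrite -eigenvalue_root_char => /eigenvalueP [u uA u0].
pose B := A - (complex.Re c)%:M; pose y := complex.Im c.
have /eqP/det0P [v v0 vB] : \det (B *m B + (y ^+ 2)%:M) = 0.
  apply: (fmorph_inj f); rewrite -det_map_mx rmorph0.
  have -> : map_mx f (B *m B + (y ^+ 2)%:M) =
      (map_mx f A - c%:M) *m (map_mx f A - (c^*)%:M).
    pose q := 'i%C * f y.
    have cE : c = f (complex.Re c) + q by rewrite /q /y; case: (c) => a b; simpc.
    have ccE : c^* = f (complex.Re c) - q.
      by rewrite /q /y; case: (c) => a b; rewrite /f /=; simpc.
    have q2 : f (y ^+ 2) = - (q * q).
      by rewrite rmorphXn -expr2 exprMn sqr_i mulN1r opprK.
    rewrite map_mxD map_mxM map_mxB !map_scalar_mx -/f q2.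
    set X := map_mx f A - _.
    have -> : map_mx f A - c%:M = X - q%:M.
      by rewrite {1}cE raddfD opprD addrA.
    have -> : map_mx f A - (c^*)%:M = X + q%:M.
      by rewrite ccE raddfB opprB addrA addrAC.
    move: X => X; rewrite mulmxBl !mulmxDr -scalar_mxM (scalar_mxC q X) raddfN /=.
    by rewrite opprD addrA addrK.
  apply/eqP/det0P; exists u => //.
  by rewrite mulmxA (mulmxBr u) uA mul_mx_scalar subrr mul0mx.
have sB : B^T = B by rewrite /B linearB /= sA tr_scalar_mx.
have e : (v *m B *m (v *m B)^T) 0 0 + y ^+ 2 * (v *m v^T) 0 0 = 0.
  have := congr1 (fun w : 'rV[R]_n.+1 => (w *m v^T) 0 0) vB.
  rewrite /= mulmxDr mulmxDl mul_mx_scalar -scalemxAl mul0mx trmx_mul sB !mulmxA.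
  rewrite [in RHS]mxE => <-; rewrite [in RHS]mxE; congr (_ + _); by rewrite [RHS]mxE.
have N0 : (v *m v^T) 0 0 != 0.
  by apply: contraNneq v0 => /mulmx_tr_eq0 ->.
have vB0 : v *m B = 0.
  apply: mulmx_tr_eq0; apply/eqP; rewrite eq_le mulmx_tr_ge0 andbT -e.
  by rewrite lerDl mulr_ge0 ?sqr_ge0 ?mulmx_tr_ge0.
pose k := (Num.sqrt ((v *m v^T) 0 0))^-1.
exists (complex.Re c), (k *: v); split.
  have -> : k *: v *m A = k *: (complex.Re c *: v).
    rewrite -scalemxAl; congr (_ *: _); apply/eqP.
    by rewrite -subr_eq0 -mul_mx_scalar -mulmxBr vB0.
  by rewrite !scalerA mulrC.
rewrite -scalemxAl linearZ /= -scalemxAr scalerA mxE -expr2 exprVn.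
  by rewrite sqr_sqrtr ?mulmx_tr_ge0 // mulVf.
Qed.

(** Reflecting in the hyperplane orthogonal to [e - v] exchanges the unit vectors [e] and [v]. The
    case [v = e], where there is nothing to reflect, is served by the identity. *)
Lemma householder (R : realFieldType) n (v : 'rV[R]_n.+1) :
  (v *m v^T) 0 0 = 1 ->
  exists H : 'M[R]_n.+1, [/\ H *m H = 1%:M, H^T = H & row 0 H = v].
Proof.
move=> nv; pose e : 'rV[R]_n.+1 := delta_mx 0 0.
have [ve|ve] := eqVneq v e.
  by exists 1%:M; rewrite mulmx1 trmx1 row1 ve.
pose w := e - v; pose k := (w *m w^T) 0 0.
have k0 : k != 0.
  by apply: contraNneq ve => /mulmx_tr_eq0 /eqP; rewrite subr_eq0 eq_sym.
have wwE : w *m w^T = k%:M by rewrite [LHS]mx11_scalar.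
(* For unit vectors |e - v|^2 = 2 - 2 v_0 = 2 w_0. This makes the coefficient [2 / k * w 0 0] of the
   first row equal to 1, so that this row is [e - w = v]. *)
have kE : k = 2 * w 0 0.
  rewrite /k /w linearB /= mulmxBr !mulmxBl.
  have ee : (e *m e^T) 0 0 = 1.
    by rewrite /e trmx_delta mul_delta_mx mxE !eqxx.
  have ev : (e *m v^T) 0 0 = v 0 0 by rewrite /e -rowE !mxE.
  have vE : (v *m e^T) 0 0 = v 0 0.
    by rewrite -[v *m _]trmxK trmx_mul trmxK [LHS]mxE.
  have mB (P Q : 'M[R]_1) : (P - Q) 0 0 = P 0 0 - Q 0 0 by rewrite !mxE.
  rewrite !mB ee ev vE nv mxE /e !mxE !eqxx /=; ring.
have wev : v = e - w by rewrite /w opprB addrC subrK.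
clearbody k w.
exists (1%:M - (2 / k) *: (w^T *m w)); split.
- rewrite mulmxBl mul1mx mulmxBr mulmx1 -scalemxAl -scalemxAr mulmxA.
  rewrite -(mulmxA _ w) wwE mul_mx_scalar -scalemxAl !scalerA.
  rewrite -[RHS]addr0 -addrA; congr (_ + _).
  have -> : 2 / k * (2 / k * k) = 2 / k + 2 / k by field.
  by rewrite scalerDl opprB addrK addNr.
- by rewrite linearB linearZ /= trmx_mul trmxK trmx1.
- rewrite linearB linearZ /= row1 row_mul -/e.
  have -> : row 0 w^T = (w 0 0)%:M by apply/rowP => j; rewrite !mxE ord1 eqxx.
  rewrite mul_scalar_mx scalerA.
  have -> : 2 / k * w 0 0 = 1.
    by move: k0; rewrite kE mulf_eq0 negb_or => /andP[_ w0]; field.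
  by rewrite scale1r -wev.
Qed.

(** Induction on the size: conjugating by a Householder reflection whose first row is a unit
    eigenvector turns the first row, and by symmetry the first column, into a multiple of a basis
    vector. The remaining block is again symmetric. *)
Theorem symmetric_diagonalization (R : rcfType) n (A : 'M[R]_n) : A^T = A ->
  exists (Q : 'M[R]_n) (d : 'rV[R]_n), Q *m Q^T = 1%:M /\ A = Q^T *m diag_mx d *m Q.
Proof.
elim: n A => [|n IH] A sA.
  by exists 1%:M, 0; split; apply/matrixP => [[]].
have [a [v [vA nv]]] := @symmetric_eigenvector R n A sA.
have [H [HH sH Hv]] := @householder R n v nv.
pose B : 'M[R]_(1 + n) := H *m A *m H.
have sB : B^T = B by rewrite /B !trmx_mul sA sH mulmxA.
have rB : row 0 B = a *: delta_mx 0 0.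
  by rewrite /B -mulmxA row_mul Hv mulmxA vA -scalemxAl -Hv -row_mul HH row1.
have [Q [d [QQ AQ]]] : exists (Q : 'M[R]_n) (d : 'rV[R]_n),
    Q *m Q^T = 1%:M /\ drsubmx B = Q^T *m diag_mx d *m Q.
  by apply: IH; rewrite trmx_drsub sB.
have BdE : B = H *m A *m H by [].
clearbody B.
have rBE k : B (lshift n 0) k = a * (k == 0)%:R.
  have -> : @lshift 1 n 0 = (0 : 'I_n.+1) by apply/eqP; rewrite -val_eqE.
  by have := congr1 (fun w : 'rV_(1 + n) => w 0 k) rB; rewrite !mxE eqxx.
have ursB : ursubmx B = 0.
  by apply/matrixP => i j; rewrite 2![in LHS]mxE ord1 rBE mxE -val_eqE mulr0.
have dlsB : dlsubmx B = 0 by rewrite -sB -trmx_ursub ursB trmx0.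
have ulsB : ulsubmx B = a%:M.
  by apply/matrixP => i j; rewrite !ord1 2![in LHS]mxE rBE mxE -val_eqE mulr1.
have BE : B = block_mx a%:M 0 0 (drsubmx B) by rewrite -ulsB -ursB -dlsB submxK.
pose Q1 : 'M[R]_(1 + n) := block_mx 1%:M 0 0 Q.
have Q1Q1 : Q1 *m Q1^T = 1%:M.
  rewrite /Q1 tr_block_mx mulmx_block !trmx0 trmx1 !(mulmx0, mul0mx) !(addr0, add0r).
  by rewrite mulmx1 QQ -scalar_mx_block.
have BE2 : B = Q1^T *m diag_mx (row_mx a%:M d : 'rV_(1 + n)) *m Q1.
  rewrite BE AQ (@diag_mx_row _ n 1) /Q1 tr_block_mx !mulmx_block.
  rewrite !trmx0 trmx1 !(mulmx0, mul0mx) !(addr0, add0r) !mul1mx !mulmx1.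
  by congr block_mx; rewrite ?mul0mx //; apply/matrixP => i j; rewrite !ord1 !mxE.
exists (Q1 *m H), (row_mx a%:M d : 'rV_(1 + n)); split.
  by rewrite trmx_mul sH mulmxA -(mulmxA Q1) HH mulmx1.
have -> : A = H *m B *m H.
  by rewrite BdE !mulmxA HH mul1mx -mulmxA HH mulmx1.
by rewrite BE2 trmx_mul sH !mulmxA.
Qed.

(** * Quadratic forms and ordered eigenvalues *)

Definition dotv (R : realType) n (u v : 'cV[R]_n) : R := \sum_i u i 0 * v i 0.

Definition qform (R : realType) n (A : 'M[R]_n) (z : 'cV[R]_n) : R := dotv z (A *m z).

Section Dot.
Context {R : realType}.

Lemma dotvE n (u v : 'cV[R]_n) : dotv u v = (u^T *m v) 0 0.
Proof. by rewrite mxE; apply: eq_bigr => i _; rewrite mxE. Qed.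

Lemma dotvC n (u v : 'cV[R]_n) : dotv u v = dotv v u.
Proof. by apply: eq_bigr => i _; rewrite mulrC. Qed.

Lemma dotvDl n (u v w : 'cV[R]_n) : dotv (u + v) w = dotv u w + dotv v w.
Proof. by rewrite /dotv -big_split; apply: eq_bigr => i _; rewrite mxE mulrDl. Qed.

Lemma dotvDr n (u v w : 'cV[R]_n) : dotv w (u + v) = dotv w u + dotv w v.
Proof. by rewrite dotvC dotvDl !(dotvC w). Qed.

Lemma dotvZl n a (u w : 'cV[R]_n) : dotv (a *: u) w = a * dotv u w.
Proof. by rewrite /dotv big_distrr; apply: eq_bigr => i _; rewrite mxE -mulrA. Qed.

Lemma dotvZr n a (u w : 'cV[R]_n) : dotv w (a *: u) = a * dotv w u.
Proof. by rewrite dotvC dotvZl dotvC. Qed.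

Lemma dotvNl n (u w : 'cV[R]_n) : dotv (- u) w = - dotv u w.
Proof. by rewrite -scaleN1r dotvZl mulN1r. Qed.

Lemma dotvNr n (u w : 'cV[R]_n) : dotv w (- u) = - dotv w u.
Proof. by rewrite dotvC dotvNl dotvC. Qed.

Lemma dotv0l n (w : 'cV[R]_n) : dotv 0 w = 0.
Proof. by rewrite /dotv big1 // => i _; rewrite mxE mul0r. Qed.

Lemma dotv_mull m n (A : 'M[R]_(m, n)) u v : dotv (A *m u) v = dotv u (A^T *m v).
Proof. by rewrite !dotvE trmx_mul mulmxA. Qed.

Lemma dotvv_ge0 n (v : 'cV[R]_n) : 0 <= dotv v v.
Proof. by apply: sumr_ge0 => i _; rewrite -expr2 sqr_ge0. Qed.

Lemma dotvv_eq0 n (v : 'cV[R]_n) : (dotv v v == 0) = (v == 0).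
Proof.
apply/idP/eqP => [|->]; last by rewrite dotv0l.
rewrite psumr_eq0 => [/allP h|i _]; last by rewrite -expr2 sqr_ge0.
apply/colP => i; have := h i (mem_index_enum i).
by rewrite -expr2 sqrf_eq0 => /eqP ->; rewrite mxE.
Qed.

Lemma norm2_ge0 n (v : 'cV[R]_n) : 0 <= norm2 v.
Proof. exact: sqrtr_ge0. Qed.

Lemma norm2_sqr n (v : 'cV[R]_n) : norm2 v ^+ 2 = dotv v v.
Proof.
rewrite sqr_sqrtr; last by apply: sumr_ge0 => i _; rewrite sqr_ge0.
by apply: eq_bigr => i _; rewrite expr2.
Qed.

Lemma cauchy_schwarz n (u v : 'cV[R]_n) : `|dotv u v| <= norm2 u * norm2 v.
Proof.
rewrite -(ler_pXn2r (n := 2)) ?nnegrE ?mulr_ge0 ?norm2_ge0 //.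
rewrite real_normK ?num_real // exprMn !norm2_sqr.
have [->|v0] := eqVneq v 0; first by rewrite dotvC !dotv0l expr0n mulr0.
have vv0 : 0 < dotv v v by rewrite lt_def dotvv_eq0 v0 dotvv_ge0.
suff : 0 <= dotv v v * (dotv u u * dotv v v - dotv u v ^+ 2).
  by rewrite pmulr_rge0 // subr_ge0.
have := dotvv_ge0 (dotv v v *: u - dotv u v *: v).
rewrite !(dotvDl, dotvDr, dotvNl, dotvNr, dotvZl, dotvZr) (dotvC v u).
by congr (0 <= _); ring.
Qed.

Lemma qform_gram m n (A : 'M[R]_(m, n)) z :
  qform (A^T *m A) z = dotv (A *m z) (A *m z).
Proof. by rewrite /qform dotv_mull mulmxA. Qed.

Lemma qformD n (A B : 'M[R]_n) z : qform (A + B) z = qform A z + qform B z.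
Proof. by rewrite /qform mulmxDl dotvDr. Qed.

Lemma qformZ n a (A : 'M[R]_n) z : qform (a *: A) z = a * qform A z.
Proof. by rewrite /qform -scalemxAl dotvZr. Qed.

End Dot.

(** * Min-max bounds for ordered eigenvalues, and the operator norm *)

Section Spectral.
Context {R : realType}.

Lemma char_poly_orth n (Q : 'M[R]_n) (d : 'rV[R]_n) : Q *m Q^T = 1%:M ->
  char_poly (Q^T *m diag_mx d *m Q) = \prod_i ('X - (d 0 i)%:P).
Proof.
move=> QQ; have QQ' := mulmx1C QQ.
rewrite -[RHS](_ : char_poly (diag_mx d) = _); last first.
  rewrite char_poly_trig; last first.
    by apply/is_trig_mxP => i j ij; rewrite mxE -val_eqE /= ltn_eqF.
  by apply: eq_bigr => i _; rewrite mxE eqxx mulr1n.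
rewrite /char_poly.
have -> : char_poly_mx (Q^T *m diag_mx d *m Q) =
    map_mx polyC Q^T *m char_poly_mx (diag_mx d) *m map_mx polyC Q.
  rewrite /char_poly_mx mulmxBr mulmxBl !map_mxM; congr (_ - _).
  by rewrite mul_mx_scalar -scalemxAl -map_mxM QQ' map_mx1 scalemx1.
rewrite !det_mulmx mulrC mulrA -det_mulmx -map_mxM QQ map_mx1 det1 mul1r //.
Qed.

Lemma spectrum_of_inj n (A : 'M[R]_n) s t :
  spectrum_of A s -> spectrum_of A t -> s = t.
Proof.
move=> [s1 s2] [t1 t2]; apply: (sorted_eq (leT := fun a b : R => b <= a)) => //.
- by move=> x y z xy zx; apply: le_trans zx xy.
- by move=> x y /andP[xy yx]; apply/eqP; rewrite eq_le xy yx.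
- by apply: prod_XsubC_eq; rewrite -s2 -t2.
Qed.

(** [spectrum] selects a list by choice. A descending list of roots is unique, so exhibiting one
    determines the selected one. *)
Lemma spectrumE n (A : 'M[R]_n) s : spectrum_of A s -> spectrum A = s.
Proof.
move=> As; rewrite /spectrum; case: pselect => [h|]; last by case; exists s.
by apply: (@spectrum_of_inj n A) => //; case: cid.
Qed.

(** Sorting the diagonal entries permutes them, and permuting the rows of [Q0] in the same way keeps
    the factorization. The sorted list is then the spectrum. *)
Lemma eigval_diagonalization n (A : 'M[R]_n) : A^T = A ->
  exists Q : 'M[R]_n, [/\ Q *m Q^T = 1%:M,
    A = Q^T *m diag_mx (\row_i eigval A i.+1) *m Q &
    forall i j, (0 < i)%N -> (i <= j <= n)%N -> eigval A j <= eigval A i].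
Proof.
move=> sA; have [Q0 [d0 [QQ AQ]]] := symmetric_diagonalization sA.
pose ge := fun a b : R => b <= a.
pose t := [tuple d0 0 i | i < n].
have /tuple_permP [p sp] : perm_eq (sort ge t) t by rewrite perm_sort.
have ssp : sorted ge (sort ge t).
  by apply: sort_sorted => x y; rewrite orbC; exact: le_total.
pose Q := row_perm p Q0; pose d := \row_i d0 0 (p i).
have spE : sort ge t = [seq d 0 i | i <- enum 'I_n].
  by rewrite sp /=; apply: eq_map => i; rewrite tnth_mktuple mxE.
have QQp : Q *m Q^T = 1%:M.
  apply/matrixP => i j; have /matrixP/(_ (p i) (p j)) := QQ.
  rewrite !mxE (inj_eq perm_inj) => <-.
  by apply: eq_bigr => k _; rewrite !mxE.
have AQp : A = Q^T *m diag_mx d *m Q.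
  rewrite AQ; apply/matrixP => i j; rewrite !mul_mx_diag !mxE.
  rewrite (reindex_inj (@perm_inj _ p)) /=; apply: eq_bigr => k _.
  by rewrite !mxE.
have spA : spectrum A = sort ge t.
  apply: spectrumE; split=> //.
  rewrite AQp char_poly_orth // spE big_map big_enum //.
have eE i : eigval A (nat_of_ord i).+1 = d 0 i.
  rewrite /eigval spA spE /= (nth_map i) ?size_enum_ord //.
  by rewrite nth_ord_enum.
exists Q; split=> //.
- by rewrite [LHS]AQp; congr (_ *m diag_mx _ *m _); apply/rowP => i; rewrite [RHS]mxE eE.
- move=> [//|i] [//|j] _ /andP[ij jn]; rewrite /eigval /= spA.
  apply: (sorted_leq_nth _ _ 0 ssp) => //.
  - by move=> x y z xy zx; apply: le_trans zx xy.
  - by move=> x; rewrite /ge.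
  - by rewrite inE size_sort size_tuple (leq_trans _ jn).
  - by rewrite inE size_sort size_tuple.
Qed.

Lemma qform_diag n (Q : 'M[R]_n) (d : 'rV[R]_n) z :
  qform (Q^T *m diag_mx d *m Q) z = \sum_i d 0 i * (Q *m z) i 0 ^+ 2.
Proof.
rewrite /qform -!mulmxA dotvC dotv_mull trmxK.
rewrite mul_diag_mx; apply: eq_bigr => i _; rewrite [X in X * _]mxE.
by rewrite -mulrA -expr2.
Qed.

Lemma dotvv_orth n (Q : 'M[R]_n) z : Q *m Q^T = 1%:M ->
  dotv z z = \sum_i (Q *m z) i 0 ^+ 2.
Proof.
move=> /mulmx1C QQ; transitivity (dotv (Q *m z) (Q *m z)).
  by rewrite dotv_mull mulmxA QQ mul1mx.
by apply: eq_bigr => i _; rewrite expr2.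
Qed.

Lemma orth_diag_mul n (Q : 'M[R]_n) (e f : 'rV[R]_n) : Q *m Q^T = 1%:M ->
  (Q^T *m diag_mx e *m Q) *m (Q^T *m diag_mx f *m Q) =
  Q^T *m diag_mx (\row_i (e 0 i * f 0 i)) *m Q.
Proof.
move=> QQ; rewrite !mulmxA -(mulmxA _ Q) QQ mulmx1 -(mulmxA _ (diag_mx e)).
congr (_ *m _ *m _); rewrite mul_diag_mx.
by apply/matrixP => i j; rewrite !mxE mulrnAr.
Qed.

Lemma orth_diag_sym n (Q : 'M[R]_n) (e : 'rV[R]_n) :
  (Q^T *m diag_mx e *m Q)^T = Q^T *m diag_mx e *m Q.
Proof. by rewrite !trmx_mul trmxK tr_diag_mx mulmxA. Qed.

Lemma qform_le_eigval1 n (A : 'M[R]_n) z : A^T = A ->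
  qform A z <= eigval A 1 * dotv z z.
Proof.
move=> sA; have [Q [QQ AQ le]] := eigval_diagonalization sA.
rewrite {1}AQ qform_diag (dotvv_orth _ QQ) mulr_sumr; apply: ler_sum => i _.
by rewrite mxE ler_wpM2r ?sqr_ge0 // le //= ltn_ord.
Qed.

Lemma exists_row_kernel p q (B : 'M[R]_(p, q)) : (q < p)%N ->
  exists2 w : 'rV[R]_p, w != 0 & w *m B = 0.
Proof.
move=> qp; have : kermx B != 0.
  rewrite kermx_eq0 /row_free neq_ltn; apply/orP; left.
  exact: leq_ltn_trans (rank_leq_col B) qp.
by case/rowV0Pn => w /sub_kermxP wB w0; exists w.
Qed.

(** One half of Courant-Fischer. The [r] constraints from [W] and orthogonality to the top
    [n - r - 1] eigenvectors make [n - 1] linear conditions, so some nonzero vector meets them all.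
    On it the form is at most the eigenvalue of index [n - r] times the squared norm. *)
Lemma eigval_ge n r (A : 'M[R]_n) (W : 'M[R]_(n, r)) c : A^T = A -> (r < n)%N ->
  (forall z, W^T *m z = 0 -> c * dotv z z <= qform A z) ->
  c <= eigval A (n - r).
Proof.
move=> sA rn h; have [Q [QQ AQ le]] := eigval_diagonalization sA.
have kn : ((n - r).-1 <= n)%N by rewrite (leq_trans (leq_pred _)) ?leq_subr.
pose Qt : 'M[R]_((n - r).-1, n) := rowsub (widen_ord kn) Q.
have nr : (0 < n - r)%N by rewrite subn_gt0.
have [|w w0] := exists_row_kernel (row_mx W Qt^T).
  by rewrite -ltn_subRL ltn_predL.
rewrite mul_mx_row -row_mx0 => /eq_row_mx [wW wQ].
have := h w^T; rewrite -trmx_mul wW trmx0 => /(_ erefl).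
rewrite {1}AQ qform_diag (dotvv_orth _ QQ).
set y := Q *m w^T => hc.
have y0 (i : 'I_n) : (i < (n - r).-1)%N -> y i 0 = 0.
  move=> ik; have /matrixP/(_ 0 (Ordinal ik)) := wQ; rewrite !mxE => e.
  rewrite -[RHS]e; apply: eq_bigr => j _; rewrite !mxE mulrC; congr (_ * Q _ _).
  exact: val_inj.
have pos : 0 < \sum_i y i 0 ^+ 2.
  rewrite -(dotvv_orth _ QQ) lt_def dotvv_ge0 dotvv_eq0 andbT.
  by apply: contraNneq w0 => /(congr1 trmx); rewrite trmxK trmx0 => ->.
rewrite -(ler_pM2r pos); apply: le_trans hc _.
rewrite mulr_sumr; apply: ler_sum => i _.
have [ik|ik] := ltnP i (n - r).-1; first by rewrite y0 // expr0n /= !mulr0.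
by rewrite mxE ler_wpM2r ?sqr_ge0 // le // ltn_ord andbT -(prednK nr) ltnS.
Qed.

(** If the bound failed at [z], the span of [z] and the [r] kernel vectors [U] would meet the span
    of the top [n - r] eigenvectors in some [s = U a + b z] with [(a, b)] nonzero. Kernel directions
    add length to [s] without adding to its form, which forces first [b = 0] and then [a = 0]. *)
Lemma eigval_le n r (A : 'M[R]_n) (U : 'M[R]_(n, r)) z : A^T = A -> (r < n)%N ->
  (forall z, 0 <= qform A z) -> row_free U^T -> A *m U = 0 -> U^T *m z = 0 ->
  eigval A (n - r) * dotv z z <= qform A z.
Proof.
move=> sA rn psd fU AU Uz; rewrite leNgt; apply/negP => lt.
have [Q [QQ AQ le]] := eigval_diagonalization sA.
have nr : (0 < n - r)%N by rewrite subn_gt0.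
have kn : ((n - r) + r = n)%N by rewrite subnK // ltnW.
pose f (i : 'I_r) := cast_ord kn (rshift (n - r) i).
pose Qb : 'M[R]_(r, n) := rowsub f Q.
have [//|w w0] := exists_row_kernel (col_mx U^T z^T *m Qb^T).
  by rewrite addn1.
rewrite -(hsubmxK w); set a := lsubmx w; set b := (rsubmx w) 0 0.
have bE : rsubmx w = b%:M by rewrite [LHS]mx11_scalar.
rewrite mulmxA mul_row_col bE mul_scalar_mx.
set s := (a *m U^T + b *: z^T)^T.
have sT : a *m U^T + b *: z^T = s^T by rewrite trmxK.
rewrite sT => sQ.
have sE : s = U *m a^T + b *: z by rewrite /s linearD linearZ /= trmx_mul !trmxK.
have Az : dotv z (U *m a^T) = 0.
  by rewrite dotvC dotv_mull Uz dotvC dotv0l.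
have As : qform A s = b ^+ 2 * qform A z.
  rewrite /qform sE mulmxDr mulmxA AU mul0mx add0r -scalemxAr dotvZr dotvDl dotvZl.
  have -> : dotv (U *m a^T) (A *m z) = 0.
    by rewrite -sA -dotv_mull mulmxA AU mul0mx dotv0l.
  by rewrite add0r mulrA -expr2.
have ss : dotv s s = dotv (U *m a^T) (U *m a^T) + b ^+ 2 * dotv z z.
  rewrite sE !(dotvDl, dotvDr, dotvZl, dotvZr) Az dotvC Az !(mulr0, addr0, add0r).
  by rewrite mulrA -expr2.
(* The negated goal [lt] bounds a nonnegative form strictly from above, so the eigenvalue is
   positive. *)
have l0 : 0 < eigval A (n - r).
  have zz : 0 < dotv z z.
    rewrite lt_def dotvv_ge0 dotvv_eq0 andbT; apply: contraTneq lt => ->.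
    by rewrite -leNgt dotv0l mulr0 psd.
  by rewrite -(pmulr_lgt0 _ zz); apply: le_lt_trans lt; exact: psd.
have y0 (i : 'I_n) : (n - r <= i)%N -> (Q *m s) i 0 = 0.
  move=> ik; have ir : (i - (n - r) < r)%N by rewrite ltn_subLR // kn.
  have /matrixP/(_ 0 (Ordinal ir)) := sQ; rewrite !mxE => e.
  rewrite -[RHS]e; apply: eq_bigr => j _; rewrite !mxE mulrC; congr (_ * Q _ _).
  by apply: val_inj; rewrite /= subnKC.
have up : eigval A (n - r) * dotv s s <= qform A s.
  rewrite [X in qform X]AQ qform_diag (dotvv_orth _ QQ) mulr_sumr.
  apply: ler_sum => i _; have [ik|ik] := ltnP i (n - r); last first.
    by rewrite y0 // expr0n /= !mulr0.
  by rewrite mxE ler_wpM2r ?sqr_ge0 // le // ik leq_subr.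
move: up; rewrite As ss mulrDr mulrCA => up.
have b0 : b = 0.
  apply/eqP; apply: contraTT isT => b0.
  have b2 : 0 < b ^+ 2 by rewrite exprn_even_gt0.
  suff : false by [].
  have : 0 <= b ^+ 2 * (qform A z - eigval A (n - r) * dotv z z).
    rewrite mulrBr subr_ge0; apply: le_trans up.
    by rewrite lerDr mulr_ge0 ?(ltW l0) ?dotvv_ge0.
  by rewrite pmulr_rge0 // subr_ge0 leNgt lt.
move: up; rewrite b0 expr0n /= !mul0r addr0 pmulr_rle0 // => up.
have : U *m a^T = 0 by apply/eqP; rewrite -dotvv_eq0 eq_le up dotvv_ge0.
move=> /(congr1 trmx); rewrite trmx_mul trmxK trmx0 => aU.
move/eqP: w0; apply; rewrite -(hsubmxK w) bE b0 -/a.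
have -> : a = 0 by apply: (row_free_inj fU); rewrite mul0mx.
by rewrite raddf0 row_mx0.
Qed.

Lemma eigval_ge0 n (A : 'M[R]_n) k : A^T = A -> (forall z, 0 <= qform A z) ->
  (0 < k <= n)%N -> 0 <= eigval A k.
Proof.
move=> sA psd /andP[k0 kn]; have [Q [QQ AQ le]] := eigval_diagonalization sA.
have ik : (k.-1 < n)%N by rewrite prednK.
have := psd (Q^T *m delta_mx (Ordinal ik) 0).
rewrite {1}AQ qform_diag mulmxA QQ mul1mx (bigD1 (Ordinal ik)) //= big1 ?addr0.
  by rewrite !mxE !eqxx /= expr1n mulr1 prednK.
by move=> i ne; rewrite !mxE (negbTE ne) /= expr0n mulr0.
Qed.

(** [sup] has its meaning only on a nonempty bounded set. The bound is the square root of the top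
    eigenvalue of the Gram matrix, with an absolute value so that its sign need not be discussed. *)
Lemma opnorm2_has_sup m n (A : 'M[R]_(m, n)) :
  has_sup [set norm2 (A *m v) | v in [set v : 'cV[R]_n | norm2 v <= 1]]%classic.
Proof.
split.
  exists (norm2 (A *m 0)); exists 0 => //=.
  by rewrite /norm2 big1 ?sqrtr0 // => i _; rewrite mxE expr0n.
exists (Num.sqrt (`|eigval (A^T *m A) 1|)) => _ [v v1 <-].
rewrite -(ler_pXn2r (n := 2)) ?nnegrE ?norm2_ge0 ?sqrtr_ge0 //.
rewrite norm2_sqr sqr_sqrtr // -qform_gram.
apply: le_trans (qform_le_eigval1 _ _) _; first by rewrite trmx_mul trmxK.
apply: le_trans (ler_wpM2r (dotvv_ge0 _) (ler_norm _)) _.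
rewrite ler_piMr // -norm2_sqr exprn_ile1 ?norm2_ge0 //.
Qed.

Lemma opnorm2_ge0 m n (A : 'M[R]_(m, n)) : 0 <= opnorm2 A.
Proof.
apply: le_trans (norm2_ge0 (A *m 0)) _; apply: sup_upper_bound.
  exact: opnorm2_has_sup.
by exists 0 => //=; rewrite /norm2 big1 ?sqrtr0 // => i _; rewrite mxE expr0n.
Qed.

Lemma norm2Z n a (v : 'cV[R]_n) : norm2 (a *: v) = `|a| * norm2 v.
Proof.
apply/eqP; rewrite -(eqrXn2 (n := 2)) ?mulr_ge0 ?norm2_ge0 //.
by rewrite exprMn !norm2_sqr dotvZl dotvZr mulrA real_normK ?num_real // expr2.
Qed.

Lemma opnorm2P m n (A : 'M[R]_(m, n)) v : norm2 (A *m v) <= opnorm2 A * norm2 v.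
Proof.
have [->|v0] := eqVneq v 0.
  rewrite mulmx0 -[X in norm2 X](scale0r 0) norm2Z normr0 mul0r.
  by rewrite mulr_ge0 ?opnorm2_ge0 ?norm2_ge0.
have nv : 0 < norm2 v.
  by rewrite lt_def norm2_ge0 andbT -sqrf_eq0 norm2_sqr dotvv_eq0.
rewrite -ler_pdivrMr // mulrC -[(norm2 v)^-1]ger0_norm ?invr_ge0 ?norm2_ge0 //.
rewrite -norm2Z scalemxAr; apply: sup_upper_bound; first exact: opnorm2_has_sup.
exists ((norm2 v)^-1 *: v) => //=.
by rewrite norm2Z ger0_norm ?invr_ge0 ?norm2_ge0 // mulVf ?gt_eqF.
Qed.

End Spectral.

(** * Subgaussian quadratic forms *)

Section Gauss.
Context {R : realType}.
Local Notation leb := (@lebesgue_measure R).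

(** Completing the square turns the integrand into a constant times the normal density of mean
    [a]. *)
Lemma gaussian_expR (a : R) :
  (\int[leb]_g (normal_pdf 0 1 g * expR (a * g))%:E = (expR (a ^+ 2 / 2))%:E)%E.
Proof.
transitivity (\int[leb]_g ((expR (a ^+ 2 / 2))%:E * (normal_pdf a 1 g)%:E))%E.
  apply: eq_integral => g _; rewrite -EFinM; congr EFin.
  rewrite !normal_pdfE ?oner_eq0 //= /normal_fun [RHS]mulrCA -mulrA -!expRD.
  by congr (_ * expR _); field.
rewrite ge0_integralZl_EFin ?expR_ge0 //=.
- by rewrite integral_normal_pdf mule1.
- by move=> g _; rewrite lee_fin normal_pdf_ge0.
- by apply/measurable_EFinP; exact: measurable_normal_pdf.
Qed.

(** The integrand is [s] times the centered normal density of standard deviation [s], where s^2 = 1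
    / (1 - 2c). *)
Lemma gaussian_expR_sqr (c : R) : 2 * c < 1 ->
  (\int[leb]_g (normal_pdf 0 1 g * expR (c * g ^+ 2))%:E =
   ((Num.sqrt (1 - 2 * c))^-1)%:E)%E.
Proof.
move=> c1; set s := (Num.sqrt (1 - 2 * c))^-1.
have s0 : 0 < s by rewrite invr_gt0 sqrtr_gt0; lra.
have s2 : s ^+ 2 = (1 - 2 * c)^-1 by rewrite exprVn sqr_sqrtr //; lra.
transitivity (\int[leb]_g (s%:E * (normal_pdf 0 s g)%:E))%E.
  apply: eq_integral => g _; rewrite -EFinM; congr EFin.
  rewrite !normal_pdfE ?oner_eq0 ?gt_eqF //= /normal_fun -[LHS]mulrA -expRD [RHS]mulrA.
  congr (_ * expR _).
    rewrite /normal_peak expr1n mul1r -mulrnAr sqrtrM ?sqr_ge0 // sqrtr_sqr.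
    by rewrite gtr0_norm // invfM mulVKf ?gt_eqF.
  by rewrite s2 expr1n; field; apply/eqP; lra.
rewrite ge0_integralZl_EFin ?ltW //=.
- by rewrite integral_normal_pdf mule1.
- by move=> g _; rewrite lee_fin normal_pdf_ge0.
- by apply/measurable_EFinP; exact: measurable_normal_pdf.
Qed.

(* [exp (k X^2)] is the Gaussian average of [exp (sqrt (2k) g X)]; Tonelli then
   lets the bound on the moment generating function act under the average. *)
Lemma subgaussian_expR_sqr d (T : measurableType d) (P : probability T R)
    (X : T -> R) (v k : R) :
  measurable_fun setT X -> 0 <= k -> 2 * (k * v) < 1 ->
  (forall t, (\int[P]_w (expR (t * X w))%:E <= (expR (t ^+ 2 * v / 2))%:E)%E) ->
  (\int[P]_w (expR (k * X w ^+ 2))%:E <= ((Num.sqrt (1 - 2 * (k * v)))^-1)%:E)%E.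
Proof.
move=> mX k0 kv mgf; pose a := Num.sqrt (2 * k).
have a2 : a ^+ 2 = 2 * k by rewrite sqr_sqrtr //; lra.
have mf (f : T * R -> R) : measurable_fun setT f -> measurable_fun setT (EFin \o f).
  by move=> ?; exact/measurable_EFinP.
pose f (x : T * R) : \bar R := (normal_pdf 0 1 x.2 * expR (a * X x.1 * x.2))%:E.
have mpdf : measurable_fun setT (normal_pdf 0 1 : R -> R) by exact: measurable_normal_pdf.
have mF : measurable_fun setT f.
  apply/measurable_EFinP; apply: measurable_funM.
    exact: (measurableT_comp mpdf measurable_snd).
  apply: measurableT_comp => //; apply: measurable_funM; last exact: measurable_snd.
  apply: measurable_funM => //; exact: (measurableT_comp mX measurable_fst).
have F0 x : (0%R <= f x)%E.
  by rewrite lee_fin mulr_ge0 ?normal_pdf_ge0 ?expR_ge0.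
have -> : (\int[P]_w (expR (k * X w ^+ 2))%:E = \int[P]_w \int[leb]_g f (w, g))%E.
  apply: eq_integral => w _; rewrite /f /= gaussian_expR exprMn a2.
  by congr (expR _)%:E; field.
rewrite (@fubini_tonelli _ _ _ _ R P leb f mF F0).
rewrite -gaussian_expR_sqr //.
apply: ge0_le_integral => //.
- by move=> g _; apply: integral_ge0 => w _; exact: F0.
- exact: measurable_fun_fubini_tonelli_G.
- apply/measurable_EFinP; apply: measurable_funM => //.
  apply: measurableT_comp => //; apply: measurable_funM => //; exact: measurable_funX.
move=> g _; rewrite /f /=.
under eq_integral do rewrite EFinM.
rewrite ge0_integralZl_EFin ?normal_pdf_ge0 //=.
- rewrite EFinM; apply: lee_wpmul2l; first by rewrite lee_fin normal_pdf_ge0.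
  under eq_integral do rewrite mulrAC.
  apply: le_trans (mgf (a * g)) _; rewrite lee_fin ler_expR exprMn a2.
  by rewrite le_eqVlt; apply/orP; left; apply/eqP; field.
- apply/measurable_EFinP; apply: measurableT_comp => //.
  by apply: measurable_funM => //; exact: measurable_funM.
Qed.

(** The exponential lies above its tangent at the mean [m], and the linear term averages to zero. *)
Lemma expR_jensen (I : finType) (p t : I -> R) : (forall i, 0 <= p i) ->
  \sum_i p i = 1 -> expR (\sum_i p i * t i) <= \sum_i p i * expR (t i).
Proof.
move=> p0 p1; set m := \sum_i p i * t i.
have -> : expR m = \sum_i p i * (expR m * (1 + (t i - m))).
  under eq_bigr do rewrite mulrCA mulrDr mulr1 mulrBr.
  by rewrite -mulr_sumr big_split /= sumrB -mulr_suml p1 -/m mul1r subrr addr0 mulr1.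
apply: ler_sum => i _; apply: ler_wpM2l => //.
have -> : expR (t i) = expR m * expR (t i - m) by rewrite -expRD addrC subrK.
by rewrite ler_wpM2l ?expR_ge0 ?expR_ge1Dx.
Qed.

End Gauss.

(** * Exponential moments and tails of |B Y|^2 for a subgaussian vector *)

Section Subgaussian.
Context {R : realType} {d} {T : measurableType d} (P : probability T R).
Variables (N : nat) (Y : T -> 'cV[R]_N) (sigma : R).
Hypothesis HY : centered_subgaussian P Y sigma.

Lemma measurable_dotv (b : 'cV[R]_N) : measurable_fun setT (fun w => dotv b (Y w)).
Proof.
case: HY => mY _; apply: measurable_sum => i; exact: measurable_funM.
Qed.

(** The definition speaks of unit vectors only; the length of [b] is moved into the scalar, and
    [b = 0] is treated apart. *)
Lemma subgaussian_mgf (b : 'cV[R]_N) t :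
  (\int[P]_w (expR (t * dotv b (Y w)))%:E <=
   (expR (t ^+ 2 * (sigma ^+ 2 * dotv b b) / 2))%:E)%E.
Proof.
have [->|b0] := eqVneq b 0.
  rewrite (eq_integral (cst 1%E)) => [|w _]; last by rewrite dotv0l mulr0 expR0.
  by rewrite integral_cst //= probability_setT mule1 dotv0l !(mulr0, mul0r) expR0.
have nb : norm2 b != 0 by rewrite -sqrf_eq0 norm2_sqr dotvv_eq0.
case: HY => _ [_ /(_ (t * norm2 b) ((norm2 b)^-1 *: b))].
rewrite norm2Z ger0_norm ?invr_ge0 ?norm2_ge0 // mulVf // => /(_ erefl).
under eq_integral => w _ do rewrite -dotvE dotvZl -mulrA mulVKf //.
move/le_trans; apply; rewrite lee_fin ler_expR exprMn norm2_sqr.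
by rewrite le_eqVlt; apply/orP; left; apply/eqP; ring.
Qed.

Variables (k : nat) (B : 'M[R]_(k, N)).
Let Q w := dotv (B *m Y w) (B *m Y w).
Let F := \sum_i \sum_j B i j ^+ 2.

Lemma measurable_mulmx_coord i : measurable_fun setT (fun w => (B *m Y w) i 0).
Proof.
rewrite (_ : (fun w => _) = (fun w => dotv (row i B)^T (Y w))).
  exact: measurable_dotv.
by apply/funext => w; rewrite dotvE trmxK -row_mul [RHS]mxE.
Qed.

Lemma measurable_subgaussian_quadratic : measurable_fun setT Q.
Proof.
by apply: measurable_sum => i; apply: measurable_funM; exact: measurable_mulmx_coord.
Qed.

(** With [b i] the rows of [B], [Q / F] is the average, with weights |b_i|^2 / F, of the squares
    <b_i, Y>^2 / |b_i|^2. Jensen reduces to these normalized squares, whose exponential moments all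
    obey the same bound; zero rows carry zero weight. *)
Lemma subgaussian_quadratic_expR c : 0 < F -> 0 <= c -> 2 * (c * sigma ^+ 2) < 1 ->
  (\int[P]_w (expR (c * (Q w / F)))%:E <=
   ((Num.sqrt (1 - 2 * (c * sigma ^+ 2)))^-1)%:E)%E.
Proof.
move=> F0 c0 cs; set K := (Num.sqrt _)^-1.
have K0 : 0 <= K by rewrite invr_ge0 sqrtr_ge0.
pose b i := (row i B)^T; pose nb i := dotv (b i) (b i).
have nbE i : nb i = \sum_j B i j ^+ 2.
  by apply: eq_bigr => j _; rewrite !mxE expr2.
pose p i := nb i / F.
have p0 i : 0 <= p i by rewrite divr_ge0 ?dotvv_ge0 ?ltW.
have p1 : \sum_i p i = 1.
  rewrite -mulr_suml; under eq_bigr do rewrite nbE.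
  by rewrite divff ?gt_eqF.
pose t i w := c / nb i * dotv (b i) (Y w) ^+ 2.
have BE i w : (B *m Y w) i 0 = dotv (b i) (Y w).
  by rewrite dotvE trmxK -row_mul [RHS]mxE.
have QE w : c * (Q w / F) = \sum_i p i * t i w.
  rewrite /Q /dotv mulr_suml mulr_sumr; apply: eq_bigr => i _.
  rewrite BE /p /t; have [z|nz] := eqVneq (nb i) 0; last first.
    by field; rewrite nz gt_eqF.
  have /eqP -> : b i == 0 by rewrite -dotvv_eq0 -/(nb i) z.
  by rewrite dotv0l expr0n /= !(mulr0, mul0r).
have mt i : measurable_fun setT (t i).
  apply: measurable_funM => //; apply: measurable_funX; exact: measurable_dotv.
have mE i : measurable_fun setT (fun w => (p i * expR (t i w))%:E).
  by apply/measurable_EFinP; apply: measurable_funM => //; exact: measurableT_comp.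
apply: (@le_trans _ _ (\int[P]_w (\sum_i (p i * expR (t i w))%:E))%E).
  apply: ge0_le_integral => //.
  - apply/measurable_EFinP; apply: measurableT_comp => //.
    apply: measurable_funM => //; apply: measurable_funM => //.
    exact: measurable_subgaussian_quadratic.
  - exact: emeasurable_sum.
  - by move=> w _; rewrite sumEFin lee_fin QE; exact: expR_jensen.
rewrite ge0_integral_sum //; last first.
  by move=> i w _; rewrite lee_fin mulr_ge0 ?p0 ?expR_ge0.
have -> : K%:E = (\sum_i (p i * K)%:E)%E by rewrite sumEFin -mulr_suml p1 mul1r.
apply: lee_sum => i _.
under eq_integral do rewrite EFinM.
rewrite ge0_integralZl_EFin //; last first.
  by apply/measurable_EFinP; exact: measurableT_comp.
have [z|nz] := eqVneq (nb i) 0.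
  by rewrite /p z !mul0r mul0e.
rewrite [X in (_ <= X)%E]EFinM.
apply: lee_wpmul2l; first by rewrite lee_fin.
rewrite /K (_ : c * sigma ^+ 2 = c / nb i * (sigma ^+ 2 * nb i)); last by field.
apply: subgaussian_expR_sqr.
- exact: measurable_dotv.
- by rewrite divr_ge0 ?dotvv_ge0.
- by rewrite [X in 2 * X](_ : _ = c * sigma ^+ 2) //; field.
- exact: subgaussian_mgf.
Qed.

(** Markov's inequality for exp (c Q / F), applied to the complementary event. The degenerate cases
    [F = 0] and [sigma = 0], in which [c] could not be formed, come first. *)
Lemma subgaussian_quadratic_tail tau : 1 <= tau ->
  ((1 - expR (- tau))%:E <=
   P [set w | (Q w <= 15 / 2 * sigma ^+ 2 * F * tau)%R])%E.
Proof.
move=> tau1; set a := 15 / 2 * _ * _ * _.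
have mQ := measurable_subgaussian_quadratic.
have mG : measurable [set w | (Q w <= a)%R].
  by rewrite -[X in measurable X]setTI; apply: measurable_fun_le.
suff : (P (~` [set w | (Q w <= a)%R]) <= (expR (- tau))%:E)%E.
  move: (probability_setC P mG) => ->.
  rewrite -(@fineK _ (P [set _ | _])) ?fin_num_measure // -!EFinB !lee_fin; lra.
have [F0|F0] := eqVneq F 0.
  have B0 : B = 0.
    apply/matrixP => i j; rewrite mxE; apply/eqP; rewrite -sqrf_eq0; move/eqP: F0.
    rewrite psumr_eq0 => [/allP/(_ i (mem_index_enum i))|u _]; last first.
      by apply: sumr_ge0 => v _; exact: sqr_ge0.
    rewrite psumr_eq0 => [/allP/(_ j (mem_index_enum j))|v _] //; exact: sqr_ge0.
  rewrite (_ : ~` _ = set0) ?measure0 ?lee_fin ?expR_ge0 //.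
  apply/seteqP; split=> w //= []; rewrite /Q B0 mul0mx dotv0l /a F0.
  by rewrite mulr0 mul0r.
have Fp : 0 < F.
  by rewrite lt_def F0; apply: sumr_ge0 => i _; apply: sumr_ge0 => j _; exact: sqr_ge0.
(* When sigma vanishes the moment bound at [c = 1] gives E exp (Q / F) <= 1. Since 1 + x <= exp x,
   the mean of the nonnegative [Q / F] is zero, hence [Q] vanishes almost everywhere. *)
have [s0|s0] := eqVneq sigma 0.
  rewrite (_ : P _ = 0%E) ?lee_fin ?expR_ge0 //.
  apply: measure_negligible; first exact: measurableC.
  have h0 w : 0 <= Q w / F by rewrite divr_ge0 ?dotvv_ge0 ?ltW.
  have mh : measurable_fun setT (fun w => (Q w / F)%:E).
    by apply/measurable_EFinP; exact: measurable_funM.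
  have : (\int[P]_w (expR (1 * (Q w / F)))%:E <= 1)%E.
    apply: le_trans (subgaussian_quadratic_expR Fp _ _) _ => //.
      by rewrite s0 expr0n /= !mulr0.
    by rewrite s0 expr0n /= !mulr0 subr0 sqrtr1 invr1.
  have : (1 + \int[P]_w (Q w / F)%:E <= \int[P]_w (expR (1 * (Q w / F)))%:E)%E.
    have -> : (1 + \int[P]_w (Q w / F)%:E = \int[P]_w (1 + (Q w / F)%:E))%E.
      rewrite ge0_integralD //; last by move=> w _; rewrite lee_fin.
      by rewrite integral_cst //= probability_setT mule1.
    apply: ge0_le_integral => //.
    - by move=> w _; rewrite -EFinD lee_fin addr_ge0.
    - exact: emeasurable_funD.
    - apply/measurable_EFinP; apply: measurableT_comp => //.
      by apply: measurable_funM => //; exact: measurable_funM.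
    - by move=> w _; rewrite -EFinD lee_fin mul1r expR_ge1Dx.
  move=> /le_trans/[apply]; rewrite -[leRHS]adde0 leeD2lE // => I0.
  have [+ _] := ae_eq_integral_abs P measurableT mh.
  case; last first.
    move=> A [mA PA sA]; exists A; split=> // w /= nw; apply: sA => /= hw.
    apply: nw; rewrite /a s0 expr0n /= mulr0 !mul0r.
    have /eqP := hw I; rewrite eqe mulf_eq0 invr_eq0 (gt_eqF Fp) orbF => /eqP -> //.
  under eq_integral do rewrite gee0_abs ?lee_fin //.
  by apply/eqP; rewrite eq_le I0; apply: integral_ge0 => w _; rewrite lee_fin.
have sp : 0 < sigma ^+ 2 by rewrite exprn_even_gt0.
(* With c sigma^2 = 3/8 the quantity 1 - 2 c sigma^2 is 1/4, a perfect square, and the moment bound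
   is exactly 2. *)
pose c := 3 / 8 / sigma ^+ 2.
have cs : c * sigma ^+ 2 = 3 / 8 by rewrite divfK ?gt_eqF.
have := @subgaussian_quadratic_expR c Fp _ _; rewrite cs.
have -> : (Num.sqrt (1 - 2 * (3 / 8)))^-1 = 2 :> R.
  have -> : 1 - 2 * (3 / 8) = (2^-1) ^+ 2 :> R by field.
  by rewrite sqrtr_sqr ger0_norm ?invrK // invr_ge0.
move=> /(_ _ _)/wrap[||I2].
- by rewrite divr_ge0 ?ltW.
- lra.
(* At the threshold [a] the exponent c Q / F equals (3/8)(15/2) tau = (45/16) tau. *)
have e0 : 0 < expR (45 / 16 * tau) by exact: expR_gt0.
have mh : measurable_fun setT (fun w => (expR (c * (Q w / F)))%:E).
  apply/measurable_EFinP; apply: measurableT_comp => //.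
  by apply: measurable_funM => //; exact: measurable_funM.
have := le_integral_comp_abse P measurableT (f := id) _ _ _ mh e0.
under eq_integral do rewrite gee0_abs ?lee_fin ?expR_ge0 //.
rewrite setTI => /(_ _ _ _)/wrap[//|//|//|mk].
have : ((expR (45 / 16 * tau))%:E * P (~` [set w | (Q w <= a)%R]) <= 2%:E)%E.
  apply: le_trans I2; apply: le_trans mk; apply: lee_wpmul2l.
    by rewrite lee_fin expR_ge0.
  apply: le_measure; rewrite ?inE; first exact: measurableC.
    rewrite -[X in measurable X]setTI; apply: emeasurable_fun_c_infty => //.
    exact: measurableT_comp.
  move=> w /= /negP; rewrite -ltNge => lt.
  rewrite ger0_norm ?expR_ge0 // lee_fin ler_expR.
  rewrite -ler_pdivrMl; last by rewrite /c; apply: divr_gt0.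
  rewrite ler_pdivlMr //; apply/ltW; apply: le_lt_trans lt.
  rewrite le_eqVlt; apply/orP; left; apply/eqP; rewrite /a /c; field.
  by rewrite s0.
rewrite -(@fineK _ (P _)) ?fin_num_measure //; last exact: measurableC.
rewrite -EFinM !lee_fin -ler_pdivlMl // => /le_trans; apply.
rewrite -expRN -ler_pdivlMl ?expR_gt0 //  -expRN opprK -expRD.
(* Absorbs the factor 2: as [1 <= tau], exp ((29/16) tau) >= 1 + 29/16 > 2. *)
have := expR_ge1Dx (29 / 16 * tau).
have -> : 45 / 16 * tau + - tau = 29 / 16 * tau by field.
by apply: le_trans; lra.
Qed.

End Subgaussian.

(** * The function lambar and compressed pseudoinverses *)

Section Lambar.
Context {R : realType}.
Variables b1 b2 b3 mu : R.
Hypotheses (b1_gt0 : 0 < b1) (b2_gt0 : 0 < b2) (b3_gt0 : 0 < b3) (mu_gt0 : 0 < mu).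
Let t := mu * b1.
Let s := Num.sqrt (b3 ^+ 2 + (t - b2) ^+ 2).

Let t_gt0 : 0 < t. Proof. by rewrite mulr_gt0. Qed.

Let s_sqr : s ^+ 2 = b3 ^+ 2 + (t - b2) ^+ 2.
Proof. by rewrite sqr_sqrtr // addr_ge0 ?sqr_ge0. Qed.

Let s_gt0 : 0 < s.
Proof. by rewrite sqrtr_gt0 ltr_wpDr ?sqr_ge0 ?exprn_gt0. Qed.

Let den_gt0 : 0 < b2 ^+ 2 + b3 ^+ 2.
Proof. by rewrite addr_gt0 ?exprn_gt0. Qed.

Lemma threshold_ltE : (t < b2 + (b3 ^+ 2 - b2 ^+ 2) / (2 * b2)) =
  (2 * b2 * t < b2 ^+ 2 + b3 ^+ 2).
Proof.
rewrite -subr_gt0 -[RHS]subr_gt0.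
rewrite (_ : b2 + _ - t = (b2 ^+ 2 + b3 ^+ 2 - 2 * b2 * t) / (2 * b2)).
  by rewrite pmulr_lgt0 ?invr_gt0 ?mulr_gt0 //; congr (0 < _); ring.
by field; rewrite gt_eqF.
Qed.

(* In the second regime [lambar'] is half the least eigenvalue of
   [[b2, - b3/2], [- b3/2, mu b1]]. *)
Lemma lambar'E : lambar' b1 b2 b3 mu =
  if 2 * b2 * t < b2 ^+ 2 + b3 ^+ 2 then b2 ^+ 2 * t / (b2 ^+ 2 + b3 ^+ 2) / 2
  else (t + b2 - s) / 4.
Proof.
rewrite /lambar' -/t threshold_ltE; case: ifP => _.
  by rewrite /t; field; rewrite gt_eqF.
rewrite -/s -mulrA -/t.
have s2 : b3 ^+ 2 = s ^+ 2 - (t - b2) ^+ 2 by rewrite s_sqr addrK.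
by rewrite s2; field; rewrite gt_eqF.
Qed.

(** In the second regime positivity means [s < t + b2], that is, after squaring, b3^2 < 4 b2 t,
    which follows from b2^2 + b3^2 <= 2 b2 t. *)
Lemma lambar'_gt0 : 0 < lambar' b1 b2 b3 mu.
Proof.
rewrite lambar'E; case: (ltP (2 * b2 * t)) => h.
  by rewrite !divr_gt0 // mulr_gt0 // exprn_gt0.
rewrite divr_gt0 // subr_gt0 -(ltr_pXn2r (n := 2)) ?nnegrE ?ltW ?addr_gt0 // s_sqr.
have b2s : 0 < b2 ^+ 2 by rewrite exprn_gt0.
have b3s : 0 < b3 ^+ 2 by rewrite exprn_gt0.
nra.
Qed.

(** The hypothesis puts [t] in the second regime, where the claim becomes [s <= t], or b2^2 + b3^2
    <= 2 b2 t after squaring. *)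
Lemma lambar'_ge : b2 + b3 ^+ 2 / b2 <= t -> b2 / 4 <= lambar' b1 b2 b3 mu.
Proof.
have b2s : 0 < b2 ^+ 2 by rewrite exprn_gt0.
have b3s : 0 < b3 ^+ 2 by rewrite exprn_gt0.
move=> h; have {}h : b2 ^+ 2 + b3 ^+ 2 <= b2 * t.
  by move: h; rewrite -(ler_pM2l b2_gt0) mulrDr mulrCA divff ?gt_eqF // mulr1 expr2.
have h2 : b2 ^+ 2 + b3 ^+ 2 <= 2 * b2 * t by lra.
rewrite lambar'E ltNge h2 /=.
rewrite ler_pM2r // (_ : (b2 <= t + b2 - s) = (s <= t)); last first.
  by rewrite -subr_ge0 -[RHS]subr_ge0; congr (0 <= _); ring.
by rewrite -(ler_pXn2r (n := 2)) ?nnegrE ?ltW // s_sqr; nra.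
Qed.

(** The ray b2 a = b3 b separates the sector where only [0 <= q] helps from the one where the
    quadratic lower bound on [q] does. The first regime compares with the value on this ray, the
    second with the least eigenvalue of the form. *)
Lemma lambar'_quadratic a b q : 0 <= a -> 0 <= b -> 0 <= q ->
  b2 * a ^+ 2 - b3 * a * b <= q ->
  2 * lambar' b1 b2 b3 mu * (a ^+ 2 + b ^+ 2) <= t * b ^+ 2 + q.
Proof.
move=> a0 b0 q0 hq; rewrite lambar'E.
have D := den_gt0; set D' := b2 ^+ 2 + b3 ^+ 2 in D *.
(* In this sector b2^2 (a^2 + b^2) <= D' b^2, so the term t b^2 alone suffices. *)
have small l : l * D' <= b2 ^+ 2 * t -> b2 * a <= b3 * b ->
    l * (a ^+ 2 + b ^+ 2) <= t * b ^+ 2 + q.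
  move=> hl hab; have [l0|l0] := lerP l 0.
    apply: (@le_trans _ _ 0); first by rewrite mulr_le0_ge0 // addr_ge0 ?sqr_ge0.
    by rewrite addr_ge0 // mulr_ge0 ?sqr_ge0 ?ltW.
  apply: (@le_trans _ _ (t * b ^+ 2)); last by rewrite lerDl.
  have sq : (b2 * a) ^+ 2 <= (b3 * b) ^+ 2.
    by rewrite ler_pXn2r ?nnegrE ?mulr_ge0 ?(ltW b2_gt0) ?(ltW b3_gt0).
  have b2s : 0 < b2 ^+ 2 by rewrite exprn_gt0.
  rewrite -(ler_pM2l b2s).
  apply: (@le_trans _ _ (l * (D' * b ^+ 2))).
    rewrite mulrCA ler_pM2l //; move: sq; rewrite /D' !exprMn; lra.
  by rewrite mulrA [leRHS]mulrA ler_wpM2r ?sqr_ge0.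
case: (ltP (2 * b2 * t)) => h.
  rewrite -[X in X * _](_ : b2 ^+ 2 * t / D' = _); last by field; rewrite gt_eqF.
  have [hab|hab] := lerP (b2 * a) (b3 * b).
    by apply: small => //; rewrite divfK ?gt_eqF.
  apply: (@le_trans _ _ (t * b ^+ 2 + (b2 * a ^+ 2 - b3 * a * b))).
    2: by rewrite lerD2l.
  rewrite mulrAC ler_pdivrMr //.
  (* The difference vanishes on the separating ray, hence the first factor. The second is
     nonnegative because b3 b < b2 a and 2 b2 t < D'. *)
  have e : (t * b ^+ 2 + (b2 * a ^+ 2 - b3 * a * b)) * D' - b2 ^+ 2 * t * (a ^+ 2 + b ^+ 2) =
     (b2 * a - b3 * b) * (a * D' - t * (b3 * b + b2 * a)) by rewrite /D'; ring.
  rewrite -subr_ge0 e mulr_ge0 ?subr_ge0 ?ltW //.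
  apply: (@lt_le_trans _ _ (t * (b2 * a + b2 * a))).
    by rewrite ltr_pM2l // ltrD2r.
  have : a * (2 * b2 * t) <= a * D' by rewrite ler_wpM2l // ltW.
  lra.
rewrite -[X in X * _](_ : (t + b2 - s) / 2 = _); last by field.
(* Subtracting the least eigenvalue leaves a singular form; multiplied by [s - al > 0] it is half a
   perfect square, because s^2 = b3^2 + al^2. *)
have psd x y : (t + b2 - s) / 2 * (x ^+ 2 + y ^+ 2) <=
    t * y ^+ 2 + (b2 * x ^+ 2 - b3 * x * y).
  have sp := s_gt0; have ss := s_sqr; pose al := t - b2.
  have al1 : 0 < s - al.
    have : al ^+ 2 < s ^+ 2 by rewrite ss ltrDr exprn_gt0.
    move=> h2; rewrite subr_gt0; have [al0|al0] := lerP al 0; first exact: le_lt_trans al0 sp.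
    by rewrite -(ltr_pXn2r (n := 2)) ?nnegrE ?ltW.
  rewrite -subr_ge0 -(pmulr_rge0 _ al1).
  have -> : (s - al) * (t * y ^+ 2 + (b2 * x ^+ 2 - b3 * x * y) -
      (t + b2 - s) / 2 * (x ^+ 2 + y ^+ 2)) =
      ((s - al) * x - b3 * y) ^+ 2 / 2 + (s ^+ 2 - (b3 ^+ 2 + al ^+ 2)) / 2 * y ^+ 2.
    by rewrite /al; field.
  by rewrite ss subrr !mul0r addr0 divr_ge0 ?sqr_ge0.
have [hab|hab] := lerP (b2 * a) (b3 * b).
  (* The point (b3, b2) lies on the separating ray, where b2 x^2 - b3 x y vanishes, so [psd] there
     is the premise of [small]. *)
  by apply: small => //; have := psd b3 b2; rewrite /D'; lra.
by apply: le_trans (psd a b) _; rewrite lerD2l.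
Qed.

End Lambar.

(** * Pseudoinverses of compressions to the range of a projector *)

Section Pinv.
Context {R : realType}.

(** [mp_pinv] falls back to zero unless a pseudoinverse exists. One is obtained by inverting the
    eigenvalues, the convention that 0 has inverse 0 handling the kernel. *)
Lemma mp_pinvP n (A : 'M[R]_n) : A^T = A -> is_MP_pinv A (mp_pinv A).
Proof.
move=> sA; rewrite /mp_pinv; case: pselect => [h|]; first by case: cid.
case; have [Q [d [QQ AQ]]] := symmetric_diagonalization sA.
exists (Q^T *m diag_mx (\row_i (d 0 i)^-1) *m Q).
rewrite AQ; split; rewrite !orth_diag_mul ?orth_diag_sym //;
  congr (_ *m diag_mx _ *m _); apply/rowP => i; rewrite !mxE; have [->|d0] := eqVneq (d 0 i) 0;
  by rewrite ?invr0 ?mul0r // ?mulfV ?mulVf ?mul1r ?mulr0.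
Qed.

(** In an eigenbasis of [S] the trace is the sum of the eigenvalues times the values of the form [D]
    at the eigenvectors. *)
Lemma mxtrace_mul_psd_ge0 n (S D : 'M[R]_n) : S^T = S ->
  (forall z, 0 <= qform S z) -> (forall z, 0 <= qform D z) -> 0 <= \tr (S *m D).
Proof.
move=> sS pS pD; have [Q [QQ SQ _]] := eigval_diagonalization sS.
rewrite {1}SQ -!mulmxA mxtrace_mulC -mulmxA mul_diag_mx.
apply: sumr_ge0 => i _; rewrite 2!mxE mulr_ge0 //.
  by apply: eigval_ge0; rewrite //= ltn_ord.
rewrite (_ : (_ *m _ *m _) i i = qform D (row i Q)^T) //.
rewrite /qform dotvE trmxK tr_row mulmxA -row_mul [LHS]mxE [RHS]mxE.
by apply: eq_bigr => j _; rewrite [in RHS]mxE [X in _ = _ * X]mxE.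
Qed.

(* With [p = X u] and [q = K u], expanding [0 <= qform B (p - q)] gives
   [qform X u <= qform K u], and the trace is monotone. *)
Lemma mxtrace_pinv_le n (A B X K : 'M[R]_n) :
  X^T = X -> K^T = K -> B^T = B -> X *m A *m X = X -> B *m K = 1%:M ->
  (forall z, 0 <= qform A z) -> (forall z, 0 <= qform B z) ->
  (forall u, qform B (X *m u) <= qform A (X *m u)) ->
  \tr (X *m X) <= \tr (K *m K).
Proof.
move=> sX sK sB XAX BK pA pB BA.
have qX u : qform A (X *m u) = qform X u.
  by rewrite /qform dotv_mull sX !mulmxA XAX.
have qK u : qform B (K *m u) = qform K u.
  by rewrite /qform dotv_mull sK !mulmxA -(mulmxA K) BK mulmx1.
have pX u : 0 <= qform X u by rewrite -qX.
have pK u : 0 <= qform K u by rewrite -qK.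
have pD u : 0 <= qform (K - X) u.
  have := pB (X *m u - K *m u); rewrite /qform mulmxBr.
  rewrite !(dotvDl, dotvDr, dotvNl, dotvNr).
  rewrite (mulmxA B K) BK mul1mx.
  have -> : dotv (K *m u) (B *m (X *m u)) = dotv u (X *m u).
    by rewrite -{1}sB -dotv_mull mulmxA BK mul1mx.
  rewrite !(dotv_mull _ u u) sX sK mulmxDl dotvDr mulNmx dotvNr.
  have := BA u; rewrite qX /qform; lra.
(* By cyclicity the mixed traces cancel; both remaining terms are traces of products of positive
   semidefinite matrices. *)
have -> : \tr (K *m K) = \tr (X *m X) + (\tr (X *m (K - X)) + \tr (K *m (K - X))).
  rewrite !mulmxBr !linearB /= (mxtrace_mulC K X); ring.
by rewrite lerDl addr_ge0 // mxtrace_mul_psd_ge0.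
Qed.

(** Row [i] of X C^T is the transpose of [C] applied to column [i] of [X], and the diagonal entry of
    X X is the squared norm of that column. *)
Lemma frobenius_mul_tr_le m n (C : 'M[R]_(m, n)) (X : 'M[R]_n) : X^T = X ->
  \sum_i \sum_j (X *m C^T) i j ^+ 2 <= opnorm2 C ^+ 2 * \tr (X *m X).
Proof.
move=> sX; rewrite mulr_sumr; apply: ler_sum => i _.
have -> : \sum_j (X *m C^T) i j ^+ 2 = norm2 (C *m col i X) ^+ 2.
  rewrite norm2_sqr; apply: eq_bigr => j _; rewrite -expr2; congr (_ ^+ 2).
  rewrite -{1}sX -trmx_mul mxE [LHS]mxE [RHS]mxE.
  by apply: eq_bigr => k _; rewrite [in RHS]mxE.
have -> : (X *m X) i i = norm2 (col i X) ^+ 2.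
  rewrite norm2_sqr -{1}sX mxE; apply: eq_bigr => k _.
  by rewrite !mxE.
rewrite -exprMn ler_pXn2r ?nnegrE ?mulr_ge0 ?norm2_ge0 ?opnorm2_ge0 //.
exact: opnorm2P.
Qed.

Variables (n : nat) (P H A : 'M[R]_n) (lb : R).
Hypotheses (sP : P^T = P) (PP : P *m P = P) (sH : H^T = H) (lb_gt0 : 0 < lb).
Hypothesis HP : forall z, P *m z = z -> lb * dotv z z <= qform H z.
Hypothesis AE : A = P *m H *m P.
Let X := mp_pinv A.

Let sA : A^T = A. Proof. by rewrite AE !trmx_mul sP sH mulmxA. Qed.
Let PA : P *m A = A. Proof. by rewrite AE !mulmxA PP. Qed.
Let AP : A *m P = A. Proof. by rewrite AE -!mulmxA PP. Qed.

Lemma qform_compress z : P *m z = z -> qform A z = qform H z.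
Proof.
by move=> Pz; rewrite /qform AE -!mulmxA Pz dotvC dotv_mull sP Pz dotvC.
Qed.

(** The columns of [Y *m A - P] lie in the range of [P] and are killed by [A], which is definite
    there. *)
Let left_inv Y : A *m Y *m A = A -> P *m Y = Y -> Y *m A = P.
Proof.
move=> AYA PY; apply/eqP; rewrite -subr_eq0; apply/eqP; set Z := Y *m A - P.
have AZ : A *m Z = 0 by rewrite mulmxBr mulmxA AYA AP subrr.
have PZ : P *m Z = Z by rewrite mulmxBr mulmxA PY PP.
apply/matrixP => i j; rewrite [RHS]mxE.
have /colP/(_ i) : col j Z = 0; last by rewrite mxE [RHS]mxE.
have Pc : P *m col j Z = col j Z by rewrite colE mulmxA PZ.
have := HP Pc; rewrite -qform_compress // /qform {4}colE mulmxA AZ mul0mx.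
rewrite (dotvC _ 0) dotv0l pmulr_rle0 // => h; apply/eqP.
by rewrite -dotvv_eq0 eq_le h dotvv_ge0.
Qed.

(** On the range of [P] the pseudoinverse is a true inverse. [left_inv] applies to [X] and to its
    transpose, and two left inverses agree, whence the symmetry. *)
Lemma pinv_compress : [/\ X^T = X, X *m A = P, A *m X = P, P *m X = X & X *m P = X].
Proof.
have [AXA XAX sAX sXA] := mp_pinvP sA; rewrite -/X in AXA XAX sAX sXA.
have PX : P *m X = X.
  by rewrite -XAX -sXA trmx_mul sA !mulmxA PA.
have XP : X *m P = X.
  have e : X = X *m X^T *m A.
    by rewrite -[LHS]XAX -mulmxA -{1}sAX trmx_mul sA mulmxA.
  by rewrite {1}e -(mulmxA _ A) AP -e.
have XA := left_inv AXA PX.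
have XTA : X^T *m A = P.
  apply: left_inv; last by rewrite -{1}sP -trmx_mul XP.
  by have := congr1 trmx AXA; rewrite !trmx_mul sA mulmxA.
have AX : A *m X = P by rewrite -sAX trmx_mul sA.
split=> //.
by rewrite -[RHS]PX -XTA -mulmxA AX -{1}PX trmx_mul sP.
Qed.

(* [p = X H x'] satisfies [lb |p|^2 <= qform A p = <p, H x'>]; with the Gram
   matrix of [M] below [A], Cauchy-Schwarz bounds that by [mu |M x|^2]. *)
Lemma pinv_bias m (M : 'M[R]_(m, n)) mu x : 0 < mu ->
  (forall z, P *m z = z -> mu * dotv (M *m z) (M *m z) <= qform H z) ->
  norm2 (X *m (mu *: (M^T *m M *m x))) ^+ 2 <= mu / lb * norm2 (M *m x) ^+ 2.
Proof.
move=> mu0 MH; have [sX XA AX PX XP] := pinv_compress.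
set u := mu *: _; set p := X *m u.
have Pp : P *m p = p by rewrite /p mulmxA PX.
have Ep : qform H p = mu * dotv (M *m p) (M *m x).
  rewrite -qform_compress // /qform /p [A *m _]mulmxA AX.
  by rewrite -{1}sP -dotv_mull -/p Pp /u dotvZr dotv_mull mulmxA.
have hM := MH _ Pp; have hL := HP Pp.
rewrite !norm2_sqr; set c := dotv (M *m x) (M *m x).
have cs : dotv (M *m p) (M *m x) <= (dotv (M *m p) (M *m p) + c) / 2.
  have := dotvv_ge0 (M *m p - M *m x).
  rewrite !(dotvDl, dotvDr, dotvNl, dotvNr) (dotvC (M *m x) (M *m p)) -/c; lra.
have {}cs := ler_wpM2l (ltW mu0) cs; rewrite -Ep in cs.
rewrite mulrAC ler_pdivlMr // mulrC; lra.
Qed.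

End Pinv.

(** * Block matrices *)

(** The Kronecker product of [H] with the identity of size [n]. *)
Definition block_scalar (R : realType) n p q (H : 'M[R]_(p, q)) :
    'M[R]_(\sum_(i < p) n, \sum_(j < q) n) :=
  \mxblock_(i < p, j < q) ((H i j)%:M : 'M[R]_n).

(** All blocks share the width [n], so block (i, j) can be a multiple of [C_ i] and no cast between
    sizes is needed. *)
Definition block_diag (R : realType) n T (m : 'I_T -> nat)
    (C_ : forall t, 'M[R]_(m t, n)) : 'M[R]_(\sum_(t < T) m t, \sum_(t < T) n) :=
  \mxblock_(i < T, j < T) ((i == j)%:R *: C_ i).

Section Blocks.
Context {R : realType}.

Lemma dotv_mxcol p (p_ : 'I_p -> nat) (u v : forall i, 'cV[R]_(p_ i)) :
  dotv (\mxcol_i u i) (\mxcol_i v i) = \sum_i dotv (u i) (v i).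
Proof.
rewrite dotvE tr_mxcol mul_mxrow_mxcol summxE.
by apply: eq_bigr => i _; rewrite dotvE.
Qed.

Lemma block_scalar_mul n p q r (G : 'M[R]_(p, q)) (H : 'M[R]_(q, r)) :
  block_scalar n G *m block_scalar n H = block_scalar n (G *m H).
Proof.
rewrite mul_mxblock; apply: eq_mxblock => i j; rewrite mxE raddf_sum.
by apply: eq_bigr => k _; rewrite -scalar_mxM.
Qed.

Lemma block_scalar_tr n p q (H : 'M[R]_(p, q)) :
  (block_scalar n H)^T = block_scalar n H^T.
Proof.
by rewrite tr_mxblock; apply: eq_mxblock => i j; rewrite tr_scalar_mx mxE.
Qed.

Lemma block_scalarD n p q (G H : 'M[R]_(p, q)) :
  block_scalar n (G + H) = block_scalar n G + block_scalar n H.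
Proof.
by rewrite -mxblockD; apply: eq_mxblock => i j; rewrite mxE raddfD.
Qed.

Lemma block_scalarZ n p q a (H : 'M[R]_(p, q)) :
  block_scalar n (a *: H) = a *: block_scalar n H.
Proof. by apply/matrixP => i j; rewrite !mxE mulrnAr. Qed.

Lemma block_scalar1 n p : block_scalar n (1%:M : 'M[R]_p) = 1%:M.
Proof.
rewrite -mxdiagZ; apply: eq_mxblock => i j; rewrite mxE.
by have [ij|ij] := eqVneq i j; [subst j; rewrite conform_mx_id|rewrite raddf0].
Qed.

Lemma mxtrace_block_scalar n p (H : 'M[R]_p) :
  \tr (block_scalar n H) = n%:R * \tr H.
Proof.
rewrite mxtrace_mxblock mulr_sumr; apply: eq_bigr => i _.
by rewrite mxtrace_scalar mulr_natl.
Qed.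

Lemma block_scalar_mxcol n p q (H : 'M[R]_(p, q)) (z : 'I_q -> 'cV[R]_n) :
  block_scalar n H *m \mxcol_j z j = \mxcol_i (\sum_j H i j *: z j).
Proof.
rewrite mul_mxblock_mxrow; apply: eq_mxcol => i.
by apply: eq_bigr => j _; rewrite mul_scalar_mx.
Qed.

Lemma block_diag_mxcol n T (m : 'I_T -> nat) (C_ : forall t, 'M[R]_(m t, n)) k
    (z : 'I_T -> 'M[R]_(n, k)) :
  block_diag C_ *m \mxcol_t z t = \mxcol_t (C_ t *m z t).
Proof.
rewrite mul_mxblock_mxrow; apply: eq_mxcol => i.
rewrite (bigD1 i) //= eqxx scale1r big1 ?addr0 // => j ji.
by rewrite eq_sym (negbTE ji) scale0r mul0mx.
Qed.

(** The Kronecker product acts separately on the time series of each of the [n] coordinates. *)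
Lemma dotv_block_scalar n p q (H : 'M[R]_(p, q)) (z : 'I_q -> 'cV[R]_n) :
  dotv (block_scalar n H *m \mxcol_j z j) (block_scalar n H *m \mxcol_j z j) =
  \sum_i qform (H^T *m H) (\col_j z j i 0).
Proof.
rewrite block_scalar_mxcol dotv_mxcol.
under [RHS]eq_bigr do rewrite qform_gram.
rewrite exchange_big; apply: eq_bigr => i _; apply: eq_bigr => e _.
have -> : (\sum_j H e j *: z j) i 0 = (H *m \col_j z j i 0) e 0; last by [].
by rewrite summxE [RHS]mxE; apply: eq_bigr => j _; rewrite !mxE.
Qed.

Lemma gram_sym m n (C : 'M[R]_(m, n)) : (C^T *m C)^T = C^T *m C.
Proof. by rewrite trmx_mul trmxK. Qed.

Lemma row_free_const1 n : (0 < n)%N -> row_free (const_mx 1 : 'cV[R]_n)^T.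
Proof.
move=> n0; rewrite /row_free rank_rV; suff -> : (const_mx 1 : 'cV[R]_n)^T != 0 by [].
apply/eqP => /matrixP/(_ 0 (Ordinal n0)).
by rewrite !mxE => /eqP; rewrite oner_eq0.
Qed.

Lemma const1_tr_mul n (z : 'cV[R]_n) : \sum_i z i 0 = 0 ->
  (const_mx 1 : 'cV[R]_n)^T *m z = 0.
Proof.
move=> z0; apply/matrixP => i j; rewrite !mxE ord1 -[RHS]z0.
by apply: eq_bigr => k _; rewrite !mxE mul1r ord1.
Qed.

(** [eigval_le] with the constant vector as the single kernel direction; index [n - 1] is the second
    smallest eigenvalue. *)
Lemma gram_gap_le m n (C : 'M[R]_(m, n)) (z : 'cV[R]_n) : (1 < n)%N ->
  C *m const_mx 1 = 0 :> 'cV[R]_m -> \sum_i z i 0 = 0 ->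
  eigval (C^T *m C) (n - 1) * dotv z z <= qform (C^T *m C) z.
Proof.
move=> n1 C1 z0; apply: (@eigval_le _ _ _ _ (const_mx 1)) => //.
- exact: gram_sym.
- by move=> w; rewrite qform_gram dotvv_ge0.
- exact: row_free_const1 (ltnW n1).
- by rewrite -mulmxA C1 mulmx0.
- exact: const1_tr_mul.
Qed.

Lemma dotv_sumr n (I : finType) (y : I -> 'cV[R]_n) v :
  dotv v (\sum_i y i) = \sum_i dotv v (y i).
Proof.
elim/big_rec2: _ => [|i a b _ <-]; last exact: dotvDr.
by rewrite dotvC dotv0l.
Qed.

Lemma qform_sum n (I : finType) (A : I -> 'M[R]_n) z :
  qform (\sum_i A i) z = \sum_i qform (A i) z.
Proof.
elim/big_rec2: _ => [|i a b _ <-]; last exact: qformD.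
by rewrite /qform mul0mx dotvC dotv0l.
Qed.

Variables (n T mE : nat) (D : 'M[R]_(mE, T)).
Variables (m : 'I_T -> nat) (C_ : forall t, 'M[R]_(m t, n)).
Hypotheses (n_gt1 : (1 < n)%N) (T_gt1 : (1 < T)%N).
Hypothesis D1 : D *m const_mx 1 = 0 :> 'cV[R]_mE.
Hypothesis C1 : forall t, C_ t *m const_mx 1 = 0 :> 'cV[R]_(m t).
Let OO := \sum_t (C_ t)^T *m C_ t.
Notation M := (block_scalar n D).
Notation C := (block_diag C_).

Lemma gram_sum_gap_le (z : 'cV[R]_n) : \sum_i z i 0 = 0 ->
  eigval OO (n - 1) * dotv z z <= qform OO z.
Proof.
move=> z0; apply: (@eigval_le _ _ _ _ (const_mx 1)) => //.
- by rewrite /OO linear_sum; apply: eq_bigr => t _; exact: gram_sym.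
- by move=> w; rewrite qform_sum sumr_ge0 // => t _; rewrite qform_gram dotvv_ge0.
- exact: row_free_const1 (ltnW n_gt1).
- by rewrite mulmx_suml big1 // => t _; rewrite -mulmxA C1 mulmx0.
- exact: const1_tr_mul.
Qed.

(* Split [z] into its mean over time [v] and the deviations [y]: the Laplacian
   controls [y], the union of the graphs controls [v], and the cross term is
   controlled by [b3]. *)
Lemma block_qform_ge b1 b2 b3 mu (z : 'I_T -> 'cV[R]_n) :
  0 < b1 -> 0 < b2 -> 0 < b3 -> 0 < mu ->
  b1 <= eigval (D^T *m D) (T - 1) ->
  b2 <= eigval OO (n - 1) / T%:R ->
  2 * opnorm2 C * Num.sqrt (eigval OO 1) / Num.sqrt T%:R <= b3 ->
  (forall t, \sum_i z t i 0 = 0) ->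
  2 * lambar' b1 b2 b3 mu * dotv (\mxcol_t z t) (\mxcol_t z t) <=
  mu * dotv (M *m \mxcol_t z t) (M *m \mxcol_t z t)
  + dotv (C *m \mxcol_t z t) (C *m \mxcol_t z t).
Proof.
move=> b1p b2p b3p mup hb1 hb2 hb3 zc.
have T0 : 0 < T%:R :> R by rewrite ltr0n ltnW.
pose v := T%:R^-1 *: \sum_t z t; pose y t := z t - v.
have zE t : z t = v + y t by rewrite /y addrC subrK.
have ys : \sum_t y t = 0.
  rewrite sumrB sumr_const card_ord -scaler_nat /v scalerA divff ?gt_eqF //.
  by rewrite scale1r subrr.
have vc : \sum_i v i 0 = 0.
  under eq_bigr do rewrite mxE summxE.
  by rewrite -mulr_sumr exchange_big /= big1 ?mulr0.
clearbody y v.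
set zz := dotv (\mxcol_t z t) _; set Y := \mxcol_t y t.
(* Pythagoras: the deviations sum to zero over time, so they are orthogonal to the [T] copies of
   [v]. *)
have zzE : zz = (Num.sqrt T%:R * norm2 v) ^+ 2 + norm2 Y ^+ 2.
  rewrite exprMn sqr_sqrtr ?ltW // !norm2_sqr /zz /Y !dotv_mxcol.
  rewrite (eq_bigr (fun t => dotv v v + 2 * dotv v (y t) + dotv (y t) (y t))).
    rewrite !big_split /= sumr_const card_ord -mulr_sumr.
    by rewrite -dotv_sumr ys (dotvC v 0) dotv0l mulr0 addr0 mulr_natl.
  by move=> t _; rewrite zE !(dotvDl, dotvDr) (dotvC (y t) v); ring.
have Mz : M *m \mxcol_t z t = M *m Y.
  rewrite !block_scalar_mxcol; apply: eq_mxcol => e.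
  under eq_bigr do rewrite zE scalerDr.
  rewrite big_split /= -scaler_suml.
  have -> : \sum_t D e t = (D *m const_mx 1 : 'cV[R]_mE) e 0.
    by rewrite mxE; apply: eq_bigr => t _; rewrite mxE mulr1.
  by rewrite D1 mxE scale0r add0r.
have hM : b1 * norm2 Y ^+ 2 <= dotv (M *m \mxcol_t z t) (M *m \mxcol_t z t).
  rewrite Mz dotv_block_scalar norm2_sqr dotv_mxcol exchange_big /= mulr_sumr.
  apply: ler_sum => i _; apply: le_trans (gram_gap_le T_gt1 D1 _).
    rewrite (_ : dotv _ _ = \sum_t y t i 0 * y t i 0).
      by apply: ler_wpM2r => //; apply: sumr_ge0 => t _; rewrite -expr2 sqr_ge0.
    by apply: eq_bigr => t _; rewrite !mxE.
  by under eq_bigr do rewrite mxE; rewrite -summxE ys mxE.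
pose p := \mxcol_t (C_ t *m v).
have Cz : C *m \mxcol_t z t = p + C *m Y.
  rewrite /Y !block_diag_mxcol -mxcolD; apply: eq_mxcol => t.
  by rewrite zE mulmxDr.
have pp : dotv p p = qform OO v.
  by rewrite dotv_mxcol qform_sum; apply: eq_bigr => t _; rewrite qform_gram.
have sOO : OO^T = OO.
  by rewrite /OO linear_sum; apply: eq_bigr => t _; exact: gram_sym.
have l1 : 0 <= eigval OO 1.
  apply: eigval_ge0; rewrite ?(ltnW n_gt1) // => w.
  by rewrite qform_sum sumr_ge0 // => t _; rewrite qform_gram dotvv_ge0.
have np : norm2 p <= Num.sqrt (eigval OO 1) * norm2 v.
  rewrite -(ler_pXn2r (n := 2)) ?nnegrE ?mulr_ge0 ?norm2_ge0 ?sqrtr_ge0 //.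
  by rewrite exprMn !norm2_sqr sqr_sqrtr // pp qform_le_eigval1.
have sT : 0 < Num.sqrt (T%:R : R) by rewrite sqrtr_gt0.
have cross : 2 * `|dotv p (C *m Y)| <= b3 * (Num.sqrt T%:R * norm2 v) * norm2 Y.
  apply: (@le_trans _ _ (2 * (Num.sqrt (eigval OO 1) * norm2 v * (opnorm2 C * norm2 Y)))).
    rewrite ler_pM2l //; apply: le_trans (cauchy_schwarz _ _) _.
    by apply: ler_pM; rewrite ?norm2_ge0 ?opnorm2P.
  rewrite ler_pdivrMr // in hb3.
  have := ler_wpM2r (mulr_ge0 (norm2_ge0 v) (norm2_ge0 Y)) hb3.
  by congr (_ <= _); ring.
have hp : b2 * (Num.sqrt T%:R * norm2 v) ^+ 2 <= dotv p p.
  rewrite pp exprMn sqr_sqrtr ?(ltW T0) // norm2_sqr mulrA.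
  apply: le_trans _ (gram_sum_gap_le vc); rewrite ler_wpM2r ?dotvv_ge0 //.
  by rewrite -ler_pdivlMr.
have Cz0 := dotvv_ge0 (C *m \mxcol_t z t).
(* The scalar inequality is used with a = sqrt T |v|, b = |Y| and q = |C z|^2. *)
rewrite zzE; apply: le_trans (lambar'_quadratic b1p b2p b3p mup _ _ Cz0 _) _.
- by rewrite mulr_ge0 ?norm2_ge0 ?sqrtr_ge0.
- exact: norm2_ge0.
- rewrite Cz !(dotvDl, dotvDr) (dotvC (C *m Y) p).
  have := ler_norm (- dotv p (C *m Y)); rewrite normrN.
  by have := dotvv_ge0 (C *m Y); lra.
- by rewrite lerD2r -mulrA ler_pM2l.
Qed.

End Blocks.

(** Column [t] is the indicator of block [t]. These columns encode the centering conditions as [T]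
    linear constraints, the form that [eigval_ge] and [eigval_le] take. *)
Definition block_ones (R : realType) n T : 'M[R]_(\sum_(t < T) n, T) :=
  \mxcol_(t < T) ((const_mx 1 : 'cV[R]_n) *m delta_mx 0 t).

(** * The blockwise centering projector and its kernel *)

Section Centering.
Context {R : realType}.

Lemma incidence_mul1 m N (s d : 'I_m -> 'I_N) :
  incidence R s d *m const_mx 1 = 0 :> 'cV[R]_m.
Proof.
apply/matrixP => e j; rewrite !mxE.
under eq_bigr do rewrite !mxE mulr1.
have one (v : 'I_N) : \sum_u (u == v)%:R = 1 :> R.
  by rewrite (bigD1 v) //= eqxx big1 ?addr0 // => u /negbTE ->.
by rewrite sumrB !one subrr.
Qed.

Lemma eq_mulmx_cV m n (A B : 'M[R]_(m, n)) :
  (forall z : 'cV_n, A *m z = B *m z) -> A = B.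
Proof.
move=> h; apply/matrixP => i j.
by have /matrixP/(_ i 0) := h (delta_mx j 0); rewrite -!colE !mxE.
Qed.

Lemma trmx_centering n : (centering R n)^T = centering R n.
Proof. by rewrite /centering linearB /= trmx1 trmx_const. Qed.

Lemma centering_mul_id n (z : 'cV[R]_n) : \sum_i z i 0 = 0 -> centering R n *m z = z.
Proof.
move=> z0; rewrite mulmxBl mul1mx -[RHS]subr0; congr (_ - _).
apply/matrixP => i j; rewrite !mxE ord1.
transitivity (n%:R^-1 * \sum_k z k 0); last by rewrite z0 mulr0.
by rewrite mulr_sumr; apply: eq_bigr => k _; rewrite mxE.
Qed.

Lemma sum_centering_mul n (z : 'cV[R]_n) : (0 < n)%N ->
  \sum_i (centering R n *m z) i 0 = 0.
Proof.
move=> n0; rewrite (eq_bigr (fun i => z i 0 - n%:R^-1 * \sum_k z k 0)); last first.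
  move=> i _; rewrite mulmxBl mul1mx !mxE mulr_sumr; congr (_ - _).
  by apply: eq_bigr => k _; rewrite mxE.
rewrite sumrB sumr_const card_ord -[_ *+ n]mulr_natl mulrA divff ?mul1r ?subrr //.
by rewrite pnatr_eq0 -lt0n.
Qed.

Variables n T : nat.
Hypothesis n_gt0 : (0 < n)%N.
Notation P := (\mxdiag_(t < T) centering R n).
Notation W := (block_ones R n T).

Lemma block_centering_mxcol (z : 'I_T -> 'cV[R]_n) :
  P *m \mxcol_t z t = \mxcol_t (centering R n *m z t).
Proof. exact: mul_mxdiag_mxcol. Qed.

Lemma block_centering_sym : P^T = P.
Proof. by rewrite tr_mxdiag; apply: eq_mxdiag => t; rewrite trmx_centering. Qed.

Lemma block_centering_idem : P *m P = P.
Proof.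
apply: eq_mulmx_cV => z; rewrite -mulmxA -(submxcolK z) !block_centering_mxcol.
by apply: eq_mxcol => t; rewrite centering_mul_id // sum_centering_mul.
Qed.

Lemma block_centering_idP (z : 'I_T -> 'cV[R]_n) :
  P *m \mxcol_t z t = \mxcol_t z t <-> forall t, \sum_i z t i 0 = 0.
Proof.
rewrite block_centering_mxcol; split=> [/eq_mxcolP e t|z0].
  by rewrite -e sum_centering_mul.
by apply: eq_mxcol => t; rewrite centering_mul_id.
Qed.

Lemma block_ones_tr_mxcol (z : 'I_T -> 'cV[R]_n) :
  W^T *m \mxcol_t z t = \col_t \sum_i z t i 0.
Proof.
rewrite /block_ones tr_mxcol mul_mxrow_mxcol; apply/matrixP => t j.
rewrite summxE (eq_bigr (fun u => (t == u)%:R * \sum_i z u i 0)); last first.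
  move=> u _; rewrite trmx_mul trmx_delta -mulmxA mxE big_ord1 mxE eqxx andbT.
  congr (_ * _); rewrite mxE; apply: eq_bigr => i _.
  by rewrite !mxE mul1r ord1.
rewrite (bigD1 t) //= eqxx mul1r [X in _ + X]big1 => [|u ut].
  by rewrite addr0 [RHS]mxE.
by rewrite eq_sym (negbTE ut) mul0r.
Qed.

Lemma block_centering_onesP (z : 'cV[R]_(\sum_(t < T) n)) :
  W^T *m z = 0 <-> P *m z = z.
Proof.
rewrite -(submxcolK z) block_ones_tr_mxcol block_centering_idP; split=> [/colP e t|e].
  by have := e t; rewrite !mxE.
by apply/colP => t; rewrite !mxE.
Qed.

(** The columns of [W] are orthogonal of squared norm [n], so a multiple of [W] is a right
    inverse. *)
Lemma row_free_block_ones : row_free W^T.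
Proof.
apply/row_freeP; exists (n%:R^-1 *: W).
rewrite -scalemxAr {2}/block_ones.
have -> : W^T *m W = n%:R%:M.
  rewrite /block_ones tr_mxcol mul_mxrow_mxcol.
  rewrite (eq_bigr (fun t => n%:R *: delta_mx t t)) => [|t _].
    by rewrite -scaler_sumr -mx1_sum_delta scalemx1.
  rewrite trmx_mul trmx_delta -mulmxA (mulmxA _ _ (delta_mx 0 t)).
  have -> : (const_mx 1 : 'cV[R]_n)^T *m const_mx 1 = n%:R%:M.
    apply/matrixP => i j; rewrite !mxE !ord1 eqxx.
    under eq_bigr do rewrite !mxE mulr1.
    by rewrite sumr_const card_ord.
  by rewrite mul_scalar_mx -scalemxAr mul_delta_mx.
by rewrite scale_scalar_mx mulVf // pnatr_eq0 -lt0n.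
Qed.

Lemma block_diag_ones (m : 'I_T -> nat) (C_ : forall t, 'M[R]_(m t, n)) :
  (forall t, C_ t *m const_mx 1 = 0 :> 'cV[R]_(m t)) -> block_diag C_ *m W = 0.
Proof.
move=> C1; rewrite /block_ones block_diag_mxcol -[RHS]mxcol0.
by apply: eq_mxcol => t; rewrite mulmxA C1 mul0mx.
Qed.

End Centering.

(** * The estimator *)

(** The inverse is diagonal in an eigenbasis of [L], with entries 1 / (lb + mu lambda_i); positivity
    of [L] keeps the denominators away from zero. *)
Lemma exists_resolvent (R : realType) T (L : 'M[R]_T) lb mu : L^T = L ->
  (forall z, 0 <= qform L z) -> 0 < lb -> 0 < mu ->
  exists K : 'M[R]_T, [/\ K^T = K, (lb%:M + mu *: L) *m K = 1%:M &
    \tr (K *m K) = \sum_(i < T) 1 / (lb + mu * eigval L i.+1) ^+ 2].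
Proof.
move=> sL pL lb0 mu0; have [Q [QQ LQ _]] := eigval_diagonalization sL.
have QQ' := mulmx1C QQ.
pose dl := \row_(i < T) eigval L i.+1; pose g := \row_(i < T) (lb + mu * eigval L i.+1)^-1.
have g0 i : lb + mu * dl 0 i != 0.
  by rewrite gt_eqF // mxE ltr_wpDr // mulr_ge0 ?(ltW mu0) // eigval_ge0 // ltn_ord.
pose S (e : 'rV[R]_T) := Q^T *m diag_mx e *m Q.
have LE : lb%:M + mu *: L = S (\row_i (lb + mu * dl 0 i)).
  have -> : \row_i (lb + mu * dl 0 i) = const_mx lb + mu *: dl.
    by apply/rowP => i; rewrite !mxE.
  rewrite /S linearD linearZ /= mulmxDr mulmxDl -scalemxAr -scalemxAl -LQ.
  by rewrite diag_const_mx mul_mx_scalar -scalemxAl QQ' scalemx1.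
exists (S g); split; first exact: orth_diag_sym.
  rewrite LE orth_diag_mul // (_ : \row_i _ = const_mx 1); last first.
    by apply/rowP => i; rewrite !mxE mulfV //; have := g0 i; rewrite mxE.
  by rewrite /S diag_const_mx mulmx1.
rewrite orth_diag_mul // -mulmxA mxtrace_mulC -mulmxA QQ mulmx1 mxtrace_diag.
by apply: eq_bigr => i _; rewrite !mxE div1r expr2 invfM.
Qed.

(** * Bounds on the compressed operator and on the estimation error *)

Section Main.
Context {R : realType}.
Variables (n T mE : nat) (D : 'M[R]_(mE, T)).
Variables (m : 'I_T -> nat) (C_ : forall t, 'M[R]_(m t, n)).
Hypotheses (n_gt1 : (1 < n)%N) (T_gt1 : (1 < T)%N).
Hypothesis D1 : D *m const_mx 1 = 0 :> 'cV[R]_mE.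
Hypothesis C1 : forall t, C_ t *m const_mx 1 = 0 :> 'cV[R]_(m t).
Notation L := (D^T *m D).
Notation OO := (\sum_t (C_ t)^T *m C_ t).
Notation M := (block_scalar n D).
Notation C := (block_diag C_).
Notation P := (\mxdiag_(t < T) centering R n).
Notation W := (block_ones R n T).
Variables b1 b2 b3 mu : R.
Hypotheses (b1_gt0 : 0 < b1) (b2_gt0 : 0 < b2) (b3_gt0 : 0 < b3) (mu_gt0 : 0 < mu).
Hypothesis b1_le : b1 <= eigval L (T - 1).
Hypothesis b2_le : b2 <= eigval OO (n - 1) / T%:R.
Hypothesis b3_ge : 2 * opnorm2 C * Num.sqrt (eigval OO 1) / Num.sqrt T%:R <= b3.
Variables H A : 'M[R]_(\sum_(t < T) n).
Hypotheses (HE : H = mu *: (M^T *m M) + C^T *m C) (AE : A = P *m H *m P).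
Notation E := (eigval (C^T *m C) (T * (n - 1))).
Notation lb := (Num.max (lambar' b1 b2 b3 mu) E).

Let n_gt0 : (0 < n)%N := ltnW n_gt1.

(** Matches the eigenvalue index of the theorem with total dimension minus the [T] centering
    constraints. *)
Lemma block_dimE : (\sum_(t < T) n - T)%N = (T * (n - 1))%N.
Proof. by rewrite sum_nat_const card_ord mulnBr muln1. Qed.

Let T_lt : (T < \sum_(t < T) n)%N.
Proof. by rewrite sum_nat_const card_ord -[X in (X < _)%N]muln1 ltn_pmul2l // ltnW. Qed.

Let lb_gt0 : 0 < lb.
Proof. by rewrite lt_max lambar'_gt0. Qed.

Lemma qform_HE z : qform H z = mu * dotv (M *m z) (M *m z) + dotv (C *m z) (C *m z).
Proof. by rewrite HE qformD qformZ !qform_gram. Qed.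

Let H_sym : H^T = H.
Proof. by rewrite HE linearD linearZ /= !gram_sym. Qed.

Let A_sym : A^T = A.
Proof. by rewrite AE !trmx_mul H_sym block_centering_sym mulmxA. Qed.

Lemma qform_HM z : mu * dotv (M *m z) (M *m z) <= qform H z.
Proof. by rewrite qform_HE lerDl dotvv_ge0. Qed.

Lemma qform_HC z : P *m z = z ->
  E * dotv z z + mu * dotv (M *m z) (M *m z) <= qform H z.
Proof.
move=> Pz; rewrite qform_HE addrC lerD2l -qform_gram -block_dimE.
apply: eigval_le T_lt _ _ _ _.
- exact: gram_sym.
- by move=> w; rewrite qform_gram dotvv_ge0.
- exact: row_free_block_ones.
- by rewrite -mulmxA block_diag_ones ?mulmx0.
- by apply/block_centering_onesP.
Qed.

Lemma qform_Hlambar z : P *m z = z ->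
  2 * lambar' b1 b2 b3 mu * dotv z z <= qform H z.
Proof.
rewrite qform_HE -(submxcolK z) => /block_centering_idP zc.
by apply: block_qform_ge => //; exact: zc.
Qed.

(** Either value of the maximum is covered: one by [qform_HC] with its Laplacian term dropped, the
    other by half of [qform_Hlambar]. *)
Lemma qform_H_ge z : P *m z = z -> lb * dotv z z <= qform H z.
Proof.
move=> Pz; have h1 := qform_HC Pz; have h2 := qform_Hlambar Pz.
have d0 := dotvv_ge0 z; have M0 := mulr_ge0 (ltW mu_gt0) (dotvv_ge0 (M *m z)).
have l0 := mulr_ge0 (ltW (lambar'_gt0 b1_gt0 b2_gt0 b3_gt0 mu_gt0)) d0.
by rewrite maxEle; case: ifP => _; lra.
Qed.

Lemma qform_H_half z : P *m z = z ->
  (lb * dotv z z + mu * dotv (M *m z) (M *m z)) / 2 <= qform H z.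
Proof.
move=> Pz; have h1 := qform_HC Pz; have h2 := qform_Hlambar Pz.
have h3 := qform_HM z; have h4 := qform_H_ge Pz.
lra.
Qed.

Lemma eigval_A_ge : lb <= eigval A (T * (n - 1)).
Proof.
rewrite -[X in eigval A X]block_dimE; apply: (@eigval_ge _ _ _ _ W) => // z.
move=> /(block_centering_onesP n_gt0) Pz; rewrite (qform_compress (block_centering_sym n T) AE) //.
exact: qform_H_ge.
Qed.

Let X := mp_pinv A.

Lemma mxtrace_pinv_A_le :
  \tr (X *m X) <= 4 * n%:R *
    (\sum_(1 <= t < T) 1 / (lb + mu * eigval L t) ^+ 2 + 1 / lb ^+ 2).
Proof.
have sP : P^T = P := block_centering_sym n T.
have PP : P *m P = P := block_centering_idem T n_gt0.
have [sX XA AX PX XP] := pinv_compress sP PP H_sym lb_gt0 qform_H_ge AE.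
have pL z : 0 <= qform L z by rewrite qform_gram dotvv_ge0.
have [K [sK LK trK]] := exists_resolvent (gram_sym D) pL lb_gt0 mu_gt0.
(* The comparison matrix: by [qform_H_half] it lies below [A] on the range of [P], and its inverse
   is the block version of [2 *: K]. Hence the trace bound 4 n tr (K^2). *)
pose B := block_scalar n (2^-1 *: (lb%:M + mu *: L)).
have qB z : qform B z = (lb * dotv z z + mu * dotv (M *m z) (M *m z)) / 2.
  rewrite /B block_scalarZ block_scalarD qformZ qformD mulrC; congr (_ / 2).
  rewrite block_scalarZ -block_scalar_mul -block_scalar_tr qformZ qform_gram.
  by rewrite -scalemx1 block_scalarZ block_scalar1 qformZ /qform mul1mx.
apply: (@le_trans _ _ (\tr (block_scalar n (2 *: K) *m block_scalar n (2 *: K)))).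
  apply: (@mxtrace_pinv_le _ _ A B).
  - exact: sX.
  - by rewrite block_scalar_tr linearZ /= sK.
  - by rewrite block_scalar_tr linearZ linearD linearZ /= gram_sym tr_scalar_mx.
  - by rewrite XA.
  - rewrite block_scalar_mul -scalemxAl -scalemxAr scalerA mulVf ?pnatr_eq0 //.
    by rewrite scale1r LK block_scalar1.
  - move=> z; rewrite AE /qform -!mulmxA dotvC dotv_mull sP dotvC.
    by apply: le_trans _ (qform_HM (P *m z)); rewrite mulr_ge0 ?dotvv_ge0 ?ltW.
  - by move=> z; rewrite qB divr_ge0 // addr_ge0 // mulr_ge0 ?dotvv_ge0 ?ltW.
  - move=> u; have Pu : P *m (X *m u) = X *m u by rewrite mulmxA PX.
    by rewrite qB (qform_compress sP AE) // qform_H_half.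
rewrite block_scalar_mul mxtrace_block_scalar -scalemxAl -scalemxAr !mxtraceZ trK.
rewrite !mulrA (_ : n%:R * 2 * 2 = 4 * n%:R); last by ring.
rewrite ler_wpM2l ?mulr_ge0 ?ler0n //.
have -> : \sum_(i < T) 1 / (lb + mu * eigval L i.+1) ^+ 2 =
    \sum_(1 <= t < T) 1 / (lb + mu * eigval L t) ^+ 2 + 1 / (lb + mu * eigval L T) ^+ 2.
  transitivity (\sum_(1 <= t < T.+1) 1 / (lb + mu * eigval L t) ^+ 2).
    by rewrite big_add1 big_mkord.
  by rewrite big_nat_recr // ltnW.
(* The term of index [T] is isolated and enlarged to 1 / lb^2, for which nonnegativity of the last
   eigenvalue suffices. *)
have lT : 0 <= mu * eigval L T.
  by rewrite mulr_ge0 ?(ltW mu_gt0) // eigval_ge0 ?gram_sym // leqnn andbT ltnW.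
have le_lb : lb <= lb + mu * eigval L T by rewrite lerDl.
have lb_gt0' := lt_le_trans lb_gt0 le_lb.
rewrite lerD2l !div1r lef_pV2 ?posrE; try exact: exprn_gt0.
by rewrite ler_pXn2r ?nnegrE ?(ltW lb_gt0) ?(ltW lb_gt0').
Qed.

Variables (xs : 'cV[R]_(\sum_(t < T) n)).
Hypothesis Pxs : P *m xs = xs.

(** As X A = P fixes [xs], one has xs = X H xs = X (mu M^T M xs) + X C^T C xs. The second part
    cancels against the signal part of the estimator. *)
Lemma estimator_error e :
  X *m C^T *m (C *m xs + e) - xs =
  X *m C^T *m e - X *m (mu *: (M^T *m M *m xs)).
Proof.
have sP : P^T = P := block_centering_sym n T.
have PP : P *m P = P := block_centering_idem T n_gt0.
have [sX XA AX PX XP] := pinv_compress sP PP H_sym lb_gt0 qform_H_ge AE.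
have xE : xs = X *m (mu *: (M^T *m M *m xs)) + X *m C^T *m (C *m xs).
  have AxE : A *m xs = P *m (H *m xs) by rewrite {1}AE -!mulmxA Pxs.
  rewrite -[LHS]Pxs -XA -mulmxA AxE mulmxA XP {1}HE mulmxDl mulmxDr -/X.
  by rewrite -scalemxAl !mulmxA.
rewrite mulmxDr; set r := X *m C^T *m (C *m xs) in xE *; set q := X *m C^T *m e.
by rewrite [X in _ - X = _]xE (addrC r q) opprD (addrC (- _)) addrA addrK.
Qed.

Lemma estimator_bound e S F : norm2 (M *m xs) ^+ 2 <= S ->
  dotv (X *m C^T *m e) (X *m C^T *m e) <= F ->
  norm2 (X *m C^T *m (C *m xs + e) - xs) ^+ 2 <= 4 * mu / lb * S + 4 / 3 * F.
Proof.
move=> hS hF; rewrite estimator_error.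
have sP : P^T = P := block_centering_sym n T.
have PP : P *m P = P := block_centering_idem T n_gt0.
have hb := pinv_bias sP PP H_sym lb_gt0 qform_H_ge AE xs mu_gt0 (fun z _ => qform_HM z).
move: hb hF; rewrite -/X; set p := X *m (mu *: _); set q := X *m C^T *m e => hb hF.
have : norm2 p ^+ 2 <= mu / lb * S.
  by apply: le_trans hb _; rewrite ler_wpM2l // divr_ge0 ?ltW.
rewrite !norm2_sqr => hp.
(* Weighted Young inequality: -2 <p, q> <= 3 |p|^2 + |q|^2 / 3, which yields the constants 4 and
   4/3. *)
have := dotvv_ge0 (q + 3 *: p).
rewrite !(dotvDl, dotvDr, dotvNl, dotvNr, dotvZl, dotvZr) (dotvC p q) => h.
have -> : 4 * mu / lb * S = 4 * (mu / lb * S) by rewrite !mulrA.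
lra.
Qed.

End Main.

Theorem theorem2 (R : realType) (n T : nat) (hn : (2 <= n)%N) (hT : (2 <= T)%N)
  (mE : nat) (src dst : 'I_mE -> 'I_T)
  (hG : simple_graph src dst) (hconn : connected_graph src dst)
  (m : 'I_T -> nat) (s d : forall t : 'I_T, 'I_(m t) -> 'I_n)
  (hGt : forall t, simple_graph (s t) (d t))
  (x : 'I_T -> 'cV[R]_n) (hx : forall t, \sum_i x t i 0 = 0)
  (dsp : measure_display) (Omega : measurableType dsp) (Pr : probability Omega R)
  (eta : forall t : 'I_T, Omega -> 'cV[R]_(m t)) (sigma : R)
  (S_T b1 b2 b3 mu : R) :
  let D : 'M[R]_(mE, T) := incidence R src dst in
  let L : 'M[R]_T := D^T *m D in
  let M : 'M[R]_(\sum_(e < mE) n, \sum_(t < T) n) :=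
    \mxblock_(e < mE, t < T) ((D e t)%:M : 'M[R]_n) in
  let C_ : forall t : 'I_T, 'M[R]_(m t, n) := fun t => incidence R (s t) (d t) in
  let C : 'M[R]_(\sum_(t < T) m t, \sum_(t < T) n) :=
    \mxblock_(i < T, j < T) ((i == j)%:R *: C_ i) in
  let OO : 'M[R]_n := \sum_(t < T) (C_ t)^T *m C_ t in
  let xs : 'cV[R]_(\sum_(t < T) n) := \mxcol_(t < T) x t in
  let etaS : Omega -> 'cV[R]_(\sum_(t < T) m t) := fun w => \mxcol_(t < T) eta t w in
  let y : Omega -> 'cV[R]_(\sum_(t < T) m t) :=
    fun w => \mxcol_(t < T) (C_ t *m x t + eta t w) in
  let P : 'M[R]_(\sum_(t < T) n) := \mxdiag_(t < T) centering R n in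
  let A : 'M[R]_(\sum_(t < T) n) := P *m (mu *: (M^T *m M) + C^T *m C) *m P in
  let lb' : R := lambar' b1 b2 b3 mu in
  let lb : R := Num.max lb' (eigval (C^T *m C) (T * (n - 1))) in
  let xhat : Omega -> 'cV[R]_(\sum_(t < T) n) := fun w => mp_pinv A *m C^T *m y w in
  0 < eigval OO (n - 1) ->
  centered_subgaussian Pr etaS sigma ->
  norm2 (M *m xs) ^+ 2 <= S_T ->
  0 < b1 -> 0 < b2 -> 0 < b3 ->
  b1 <= eigval L (T - 1) ->
  b2 <= eigval OO (n - 1) / T%:R ->
  2 * opnorm2 C * Num.sqrt (eigval OO 1) / Num.sqrt T%:R <= b3 ->
  0 < mu ->
  [/\ lb <= eigval A (T * (n - 1)),
      0 < lb',
      (b2 + b3 ^+ 2 / b2 <= mu * b1 -> b2 / 4 <= lb')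
    & forall delta : R, 0 < delta < expR (-1) ->
      ((1 - delta)%:E <=
        Pr [set w | (norm2 (xhat w - xs) ^+ 2 <=
             4 * mu / lb * S_T
             + 40 * n%:R * sigma ^+ 2 * opnorm2 C ^+ 2
               * (\sum_(1 <= t < T) 1 / (lb + mu * eigval L t) ^+ 2 + 1 / lb ^+ 2)
               * ln (1 / delta))%R])%E].
Proof.
move=> D L M C_ C OO xs etaS y P A lb' lb xhat hOO sub hS b1p b2p b3p h1 h2 h3 mup.
have D1 : D *m const_mx 1 = 0 :> 'cV[R]_mE by exact: incidence_mul1.
have C1 t : C_ t *m const_mx 1 = 0 :> 'cV[R]_(m t) by exact: incidence_mul1.
have lb'p : 0 < lb' by exact: lambar'_gt0.
have lbp : 0 < lb by rewrite lt_max lb'p.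
have Pxs : P *m xs = xs by apply/(block_centering_idP (ltnW hn)).
pose H := mu *: (M^T *m M) + C^T *m C.
pose X := mp_pinv A; pose B := X *m C^T.
split=> //.
- exact: (eigval_A_ge hn hT D1 C1 b1p b2p b3p mup h1 h2 h3 (erefl H) (erefl A)).
- exact: lambar'_ge.
move=> delta /andP[d0 de].
pose tau := ln (1 / delta); pose F := \sum_i \sum_j B i j ^+ 2.
(* The restriction of [delta] below 1/e is what gives the tail bound its premise [1 <= tau]. *)
have tau1 : 1 <= tau.
  rewrite /tau div1r lnV ?posrE // lerNr -ler_expR lnK ?posrE //.
  exact: ltW.
have eta_tau : expR (- tau) = delta.
  by rewrite /tau div1r lnV ?posrE // opprK lnK // posrE.
have yE w : y w = C *m xs + etaS w.
  by rewrite /y mxcolD; congr (_ + _); rewrite -block_diag_mxcol.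
have tail := subgaussian_quadratic_tail sub B tau1; rewrite eta_tau in tail.
(* The event of the tail bound is contained in the event of the theorem; both must be shown
   measurable before comparing their probabilities. *)
apply: le_trans tail _; apply: le_measure; rewrite ?inE.
- rewrite -[X in _.-measurable X]setTI; apply: measurable_fun_le => //.
  exact: (measurable_subgaussian_quadratic sub B).
- rewrite -[X in _.-measurable X]setTI; apply: measurable_fun_le => //.
  rewrite (_ : (fun w => _) = fun w => \sum_i (xhat w - xs) i 0 * (xhat w - xs) i 0).
    have mx i : measurable_fun setT (fun w => (xhat w - xs) i 0).
      rewrite (_ : (fun w => _) = fun w => (B *m etaS w) i 0 + (B *m (C *m xs) - xs) i 0).
        by apply: measurable_funD => //; exact: (measurable_mulmx_coord sub B i).
      apply/funext => w; rewrite /xhat yE mulmxDr -/B.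
      by rewrite -addrA addrCA mxE.
    by apply: measurable_sum => i; exact: measurable_funM.
  by apply/funext => w; rewrite norm2_sqr.
move=> w /= hw; rewrite /xhat yE.
have bd := estimator_bound hn hT D1 C1 b1p b2p b3p mup h1 h2 h3 (erefl H) (erefl A) Pxs hS hw.
apply: le_trans bd _; rewrite lerD2l.
have sH : H^T = H by rewrite /H linearD linearZ /= !gram_sym.
have [sX _ _ _ _] := pinv_compress (block_centering_sym n T)
  (block_centering_idem T (ltnW hn)) sH lbp
  (qform_H_ge hn hT D1 C1 b1p b2p b3p mup h1 h2 h3 (erefl H)) (erefl A).
have hF := frobenius_mul_tr_le C sX; rewrite -/X -/B -/F in hF.
have hX := mxtrace_pinv_A_le hn hT D1 C1 b1p b2p b3p mup h1 h2 h3 (erefl H) (erefl A).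
have {hX}hF := le_trans hF (ler_wpM2l (sqr_ge0 _) hX).
(* Here 10 = (4/3)(15/2) joins the Young and tail constants; the factor 4 n of the trace bound then
   makes 40 n. *)
have s2 : 0 <= 10 * (sigma ^+ 2 * tau).
  by apply: mulr_ge0 => //; apply: mulr_ge0; [exact: sqr_ge0|exact: le_trans tau1].
have := ler_wpM2l s2 hF; rewrite -/lb' -/lb -/L -/tau.
set G := \sum_(1 <= t < T) _ + _ => {}hF.
rewrite [leLHS](_ : _ = 10 * (sigma ^+ 2 * tau) * F); last by rewrite /F; field.
by apply: le_trans hF _; rewrite le_eqVlt; apply/orP; left; apply/eqP; ring.
Qed.
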